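(* Let $X$ be a smooth hyperquadric of dimension $\ge3$. Then for every integer $r\ge0$ there is the following irreducible decomposition: $$\mathrm{Sym}^rT_X=\begin{cases}\displaystyle\bigoplus_{i=0}^{\lfloor r/2\rfloor}E_{(r-2i)2\lambda_2+2i\lambda_1}, & X=Q^3,\\[4mm] \displaystyle\bigoplus_{i=0}^{\lfloor r/2\rfloor}E_{(r-2i)(\lambda_2+\lambda_3)+2i\lambda_1}, & X=Q^4,\\[4mm] \displaystyle\bigoplus_{i=0}^{\lfloor r/2\rfloor}E_{(r-2i)\lambda_2+2i\lambda_1}, & \text{otherwise.}\end{cases}$$
   Context: Everything is over $\mathbb{C}$. A smooth quadric is written $Q^{2n-1}\cong Spin(2n+1)/P_1$ $(n\ge2)$, with $G=Spin(2n+1)$ of type $B_n$, or $Q^{2n-2}\cong Spin(2n)/P_1$ $(n\ge3)$, with $G=Spin(2n)$ of type $D_n$. The $\lambda_i$ are the fundamental dominant weights of $G$ in Bourbaki order (for $Q^4$, type $D_3$: $\lambda_1$ is the highest weight of the 6-dimensional vector representation and $\lambda_2,\lambda_3$ those of the two half-spin representations). $P_1$ is the maximal parabolic subgroup attached to $\alpha_1$, with the convention that its Lie algebra $\mathfrak p_1$ contains all negative root spaces, so that the weights of $\mathfrak g/\mathfrak p_1$ are the positive roots involving $\alpha_1$. Homogeneous vector bundles on $G/P_1$ are identified with $P_1$-modules, $T_X$ corresponding to $\mathfrak g/\mathfrak p_1$. $E_\lambda$ denotes the irreducible homogeneous vector bundle (irreducible $P_1$-module) with highest weight $\lambda$ with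 respect to the Levi part of $P_1$. *)

(* Defs.v *)
From HB Require Import structures.
From mathcomp Require Import all_boot all_order all_algebra.
From mathcomp Require Import reals complex mpoly ring.

Set Implicit Arguments.
Unset Strict Implicit.
Unset Printing Implicit Defensive.

Import Order.TTheory GRing.Theory Num.Theory.
Local Open Scope ring_scope.

(* X = Spin(V)/P_1 is the smooth quadric of dimension m.+1, i.e. the variety of isotropic
   lines of the quadratic space V = K^(m.+3) (column vectors) with bilinear form
   (u, v) |-> \sum_i u_i v_(rev i). In this (Bourbaki's) model of so(V) the
   diagonal matrices form a Cartan subalgebra, and the positive (negative) root
   vectors are strictly upper (lower) triangular. *)

Section Clifford.
Variables (K : fieldType) (N : nat).

Definition gram : 'M[K]_N := \matrix_(i, j) (j == rev_ord i)%:R.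

Definition bil (u v : 'cV[K]_N) : K := \sum_i u i 0 * v (rev_ord i) 0.

Lemma bilE u v : u^T *m gram *m v = (bil u v)%:M.
Proof.
apply/matrixP=> a b; rewrite !ord1 !mxE eqxx mulr1n /bil.
rewrite [RHS](reindex_inj rev_ord_inj) /=; apply: eq_bigr => i _.
rewrite rev_ordK mxE (bigD1 (rev_ord i)) //= big1 ?addr0 => [|j ji].
  by rewrite !mxE rev_ordK eqxx mulr1.
rewrite !mxE (_ : (i == rev_ord j) = false) ?mulr0 //.
by apply: contra_neqF ji => /eqP ->; rewrite rev_ordK.
Qed.

(* The Clifford algebra of V is realised faithfully on the exterior algebra of
   V, whose basis vectors e_S are indexed by S : {set 'I_N}; v in V acts by
   exterior multiplication by v plus contraction with (v, -). *)
Local Notation Ext := #|{set 'I_N}|.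

Definition ext_sign (i : 'I_N) (S : {set 'I_N}) : K :=
  (-1) ^+ #|[set k in S | (k < i)%N]|.

Definition ext_mx (f : {set 'I_N} -> {set 'I_N} -> K) : 'M[K]_Ext :=
  \matrix_(a, b) f (enum_val a) (enum_val b).

Definition wedge (i : 'I_N) : 'M[K]_Ext :=
  ext_mx (fun T S => ((i \notin S) && (T == i |: S))%:R * ext_sign i S).

Definition contract (i : 'I_N) : 'M[K]_Ext :=
  ext_mx (fun T S => ((i \in S) && (T == S :\ i))%:R * ext_sign i S).

Definition cliff (v : 'cV[K]_N) : 'M[K]_Ext :=
  \sum_i v i 0 *: (wedge i + contract (rev_ord i)).

Definition is_spin (s : 'M[K]_Ext) : Prop :=
  exists vs : seq 'cV[K]_N,
    [/\ ~~ odd (size vs), all (fun v => bil v v == 1) vs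
      & s = \big[mulmx/1%:M]_(v <- vs) cliff v].

(* The vector representation Spin(V) -> SO(V): vect s v is the vector w with
   s v s^-1 = w in the Clifford algebra, read off from the fact that
   cliff w maps e_set0 to the image of w in degree 1; see vectP. *)
Definition vect (s : 'M[K]_Ext) : 'M[K]_N :=
  \matrix_(i, j) (s *m cliff (delta_mx j 0) *m invmx s)
    (enum_rank [set i]) (enum_rank set0).

Lemma cliff_is_linear : linear cliff.
Proof.
move=> a u v; rewrite /cliff scaler_sumr -big_split /=; apply: eq_bigr => i _.
by rewrite !mxE scalerDl scalerA.
Qed.
HB.instance Definition _ :=
  GRing.isLinear.Build K 'cV[K]_N 'M[K]_Ext _ cliff cliff_is_linear.

Lemma ext_signC i j (S : {set 'I_N}) : j \notin S ->
  ext_sign i (j |: S) = (-1) ^+ (j < i)%N * ext_sign i S.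
Proof.
move=> jS; rewrite /ext_sign -exprD; congr (_ ^+ _).
have -> : [set k in j |: S | (k < i)%N]
        = (if (j < i)%N then [set j] else set0) :|: [set k in S | (k < i)%N].
  apply/setP=> k; rewrite !inE; case: ifP => ji; rewrite !inE.
    by case: eqVneq => [->|//]; rewrite ji.
  by case: eqVneq => [->|//]; rewrite ji (negbTE jS).
case: ifP => _; last by rewrite set0U.
by rewrite cardsU1 !inE (negbTE jS).
Qed.

Lemma mul_wedge (A : 'M[K]_Ext) j a b : let S := enum_val b in
  (A *m wedge j) a b =
    (j \notin S)%:R * ext_sign j S * A a (enum_rank (j |: S)).
Proof.
move=> S; rewrite mxE (bigD1 (enum_rank (j |: S))) //= big1 ?addr0.
  by rewrite mxE enum_rankK eqxx andbT mulrC.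
move=> c cS; rewrite mxE (_ : enum_val c == _ = false) ?andbF ?mul0r ?mulr0 //.
by apply: contra_neqF cS => /eqP <-; rewrite enum_valK.
Qed.

Lemma mul_contract (A : 'M[K]_Ext) j a b : let S := enum_val b in
  (A *m contract j) a b =
    (j \in S)%:R * ext_sign j S * A a (enum_rank (S :\ j)).
Proof.
move=> S; rewrite mxE (bigD1 (enum_rank (S :\ j))) //= big1 ?addr0.
  by rewrite mxE enum_rankK eqxx andbT mulrC.
move=> c cS; rewrite mxE (_ : enum_val c == _ = false) ?andbF ?mul0r ?mulr0 //.
by apply: contra_neqF cS => /eqP <-; rewrite enum_valK.
Qed.

Lemma ext_signD i j (S : {set 'I_N}) : j \in S ->
  ext_sign i (S :\ j) = (-1) ^+ (j < i)%N * ext_sign i S.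
Proof.
move=> jS; rewrite -[in RHS](setD1K jS) ext_signC ?setD11 //.
by rewrite mulrA -signr_addb addbb mul1r.
Qed.

Lemma lt_sign (i j : 'I_N) : i != j ->
  (-1) ^+ (j < i)%N = - (-1) ^+ (i < j)%N :> K.
Proof.
by rewrite -val_eqE /=; case: (ltngtP i j) => //= _ _; rewrite ?expr1 ?opprK ?expr0.
Qed.

Lemma wedge_wedge i j : wedge i *m wedge j + wedge j *m wedge i = 0.
Proof.
apply/matrixP=> a b; rewrite mxE !mul_wedge !mxE !enum_rankK !inE !negb_or.
set S := enum_val b; rewrite [j |: (i |: S)]setUCA (eq_sym j i).
case: (eqVneq i j) => [_|ij] /=; first by rewrite !mul0r !mulr0 addr0.
case jS: (j \in S); case iS: (i \in S); rewrite /= ?mul0r ?mulr0 ?addr0 //.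
rewrite !mul1r !ext_signC ?iS ?jS // (lt_sign ij) !mulNr !mulrN addrC.
by apply/eqP; rewrite subr_eq0; apply/eqP; ring.
Qed.

Lemma contract_contract i j :
  contract i *m contract j + contract j *m contract i = 0.
Proof.
apply/matrixP=> a b; rewrite mxE !mul_contract !mxE !enum_rankK !inE.
set S := enum_val b; rewrite [S :\ i :\ j]setDDl [[set i] :|: _]setUC -setDDl.
rewrite (eq_sym j i).
case: (eqVneq i j) => [_|ij] /=; first by rewrite !mul0r !mulr0 addr0.
case jS: (j \in S); case iS: (i \in S); rewrite /= ?mul0r ?mulr0 ?addr0 //.
rewrite !mul1r !ext_signD ?iS ?jS // (lt_sign ij) !mulNr !mulrN addrC.
by apply/eqP; rewrite subr_eq0; apply/eqP; ring.
Qed.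

Lemma wedge_contract i j :
  wedge i *m contract j + contract j *m wedge i = (i == j)%:R%:M.
Proof.
apply/matrixP=> a b; rewrite mxE mul_wedge mul_contract !mxE !enum_rankK !inE.
rewrite -(inj_eq enum_val_inj a b); set S := enum_val b; rewrite (eq_sym j i).
have sgn2 k T : ext_sign k T * ext_sign k T = 1.
  by rewrite /ext_sign -expr2 sqrr_sign.
case: (eqVneq i j) => [<-|ij] /=.
  case iS: (i \in S); rewrite /= ?mul0r ?mulr0 ?addr0 ?add0r ?mul1r.
    by rewrite setD1K // ext_signD // ltnn mul1r mulrCA sgn2 mulr1 mulr1n.
  by rewrite setU1K ?iS // ext_signC ?iS // ltnn mul1r mulrCA sgn2 mulr1.
rewrite mul0rn.
case jS: (j \in S); case iS: (i \in S); rewrite /= ?mul0r ?mulr0 ?addr0 //.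
have -> : (i |: S) :\ j = i |: S :\ j.
  by apply/setP=> k; rewrite !inE; case: (eqVneq k i) => [->|]; rewrite ?ij.
rewrite !mul1r ext_signC ?ext_signD ?iS // (lt_sign ij) !mulNr !mulrN addrC.
by apply/eqP; rewrite subr_eq0; apply/eqP; ring.
Qed.

Lemma bilC u v : bil u v = bil v u.
Proof.
rewrite /bil [LHS](reindex_inj rev_ord_inj) /=.
by apply: eq_bigr => i _; rewrite rev_ordK mulrC.
Qed.

Lemma cliff_anticomm u v :
  cliff u *m cliff v + cliff v *m cliff u = (bil u v *+ 2)%:M.
Proof.
pose c i : 'M[K]_Ext := wedge i + contract (rev_ord i).
have cc i j : c i *m c j + c j *m c i = ((rev_ord i == j)%:R *+ 2)%:M.
  have -> : c i *m c j + c j *m c i =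
     (wedge i *m wedge j + wedge j *m wedge i)
   + (contract (rev_ord i) *m contract (rev_ord j)
      + contract (rev_ord j) *m contract (rev_ord i))
   + ((wedge i *m contract (rev_ord j) + contract (rev_ord j) *m wedge i)
      + (wedge j *m contract (rev_ord i) + contract (rev_ord i) *m wedge j)).
    rewrite /c !mulmxDl !mulmxDr.
    by rewrite [LHS](AC ((2*2)*(2*2)) (((1*5)*(4*8))*((2*7)*(6*3)))).
  rewrite wedge_wedge !contract_contract !wedge_contract !add0r.
  by rewrite -(can2_eq (@rev_ordK N) (@rev_ordK N)) (eq_sym j) -raddfD /= mulr2n.
have E w x : cliff w *m cliff x
           = \sum_i \sum_j (w i 0 * x j 0) *: (c i *m c j).
  rewrite /cliff mulmx_suml; apply: eq_bigr => i _.
  rewrite mulmx_sumr; apply: eq_bigr => j _.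
  by rewrite -scalemxAl -scalemxAr scalerA.
rewrite !E [X in _ + X]exchange_big -big_split /=.
rewrite /bil -sumrMnl raddf_sum /=; apply: eq_bigr => i _.
rewrite -big_split /= (bigD1 (rev_ord i)) //= big1 ?addr0 => [|j ji].
  by rewrite (mulrC (v _ _)) -scalerDr cc eqxx scale_scalar_mx mulrnAr mulr1.
rewrite (mulrC (v _ _)) -scalerDr cc eq_sym (negbTE ji) mul0rn.
by rewrite raddf0 scaler0.
Qed.

Lemma cliff_sqr v : 2%:R != 0 :> K -> cliff v *m cliff v = (bil v v)%:M.
Proof.
move=> nz2; apply: (scalerI nz2); rewrite !scaler_nat mulr2n cliff_anticomm.
by rewrite raddfMn.
Qed.

Lemma cliff_set0 v i : cliff v (enum_rank [set i]) (enum_rank set0) = v i 0.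
Proof.
rewrite /cliff summxE (bigD1 i) //= big1 ?addr0 => [|j ji]; rewrite !mxE !enum_rankK.
  rewrite !inE setU0 eqxx /= mul0r addr0 mul1r /ext_sign.
  rewrite (_ : [set _ in _ | _] = set0) ?cards0 ?mulr1 //.
  by apply/setP=> k; rewrite !inE.
rewrite !inE setU0 (inj_eq set1_inj) (eq_sym i) (negbTE ji) /=.
by rewrite !mul0r addr0 mulr0.
Qed.

Lemma spin_unit s : 2%:R != 0 :> K -> is_spin s -> s \in unitmx.
Proof.
move=> nz2 [vs [_ /allP vsP ->]]; rewrite big_seq.
elim/big_rec: _ => [|v t /vsP/eqP v1 tU]; first exact: unitmx1.
rewrite unitmx_mul tU andbT.
by case: (@mulmx1_unit _ _ (cliff v) (cliff v)) => //; rewrite cliff_sqr // v1.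
Qed.

Lemma vectP s v : 2%:R != 0 :> K -> is_spin s ->
  s *m cliff v *m invmx s = cliff (vect s *m v).
Proof.
move=> nz2 sS; have sU := spin_unit nz2 sS.
have [A sA] : exists A : 'M[K]_N,
    forall w, s *m cliff w *m invmx s = cliff (A *m w).
  suff [A sA] : exists A : 'M[K]_N,
      forall w, s *m cliff w = cliff (A *m w) *m s.
    by exists A => w; rewrite sA mulmxK.
  case: sS => vs [_ /allP vsP ->]; rewrite big_seq.
  elim/big_rec: _ => [|u t /vsP/eqP u1 [A tA]].
    by exists 1%:M => w; rewrite !mul1mx mulmx1.
  exists (((u *m u^T *m gram) *+ 2 - 1%:M) *m A) => w.
  rewrite -mulmxA tA !mulmxA; congr (_ *m t).
  set x := A *m w.
  have -> : ((u *m u^T *m gram) *+ 2 - 1%:M) *m A *m w = (bil u x *+ 2) *: u - x.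
    rewrite -mulmxA -/x mulmxBl mul1mx -scaler_nat -scalemxAl -!mulmxA.
    rewrite [u^T *m _]mulmxA bilE mul_mx_scalar scalerA.
    by rewrite mulr_natl.
  rewrite linearB linearZ /= mulmxBl -scalemxAl cliff_sqr // u1.
  by rewrite scale_scalar_mx mulr1 -cliff_anticomm addrK.
have vE : vect s = A.
  by apply/matrixP=> i j; rewrite mxE sA cliff_set0 -colE mxE.
by rewrite vE sA.
Qed.

Lemma bil_vect s u v : 2%:R != 0 :> K -> is_spin s ->
  bil (vect s *m u) (vect s *m v) = bil u v.
Proof.
move=> nz2 sS; have sU := spin_unit nz2 sS.
have E : (bil (vect s *m u) (vect s *m v) *+ 2)%:M
         = (bil u v *+ 2)%:M :> 'M[K]_Ext.
  rewrite -[LHS]cliff_anticomm -!vectP // !mulmxA !(mulmxKV sU) -mulmxDl.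
  rewrite -![s *m _ *m _]mulmxA -mulmxDr cliff_anticomm.
  by rewrite scalar_mxC mulmxK.
have inj (a b : K) : a%:M = b%:M :> 'M[K]_Ext -> a = b.
  move/matrixP/(_ (enum_rank set0) (enum_rank set0)).
  by rewrite !mxE eqxx !mulr1n.
by apply: (mulfI nz2); rewrite !mulr_natl; apply: inj.
Qed.

Lemma gramK : gram *m gram = 1%:M.
Proof.
apply/matrixP=> i j; rewrite mxE (bigD1 (rev_ord i)) //= big1 ?addr0.
  by rewrite !mxE rev_ordK !eqxx mul1r eq_sym.
by move=> k ki; rewrite !mxE (negbTE ki) mul0r.
Qed.

Lemma vect_gram s : 2%:R != 0 :> K -> is_spin s ->
  (vect s)^T *m gram *m vect s = gram.
Proof.
move=> nz2 sS; apply/matrixP=> i j.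
have H (A : 'M[K]_N) :
    A i j = ((delta_mx i 0 : 'cV[K]_N)^T *m A *m (delta_mx j 0 : 'cV_N)) 0 0.
  by rewrite trmx_delta -rowE -colE !mxE.
rewrite [LHS]H [RHS]H !mulmxA -trmx_mul -mulmxA bilE -!mulmxA mulmxA.
by rewrite bilE bil_vect.
Qed.

Lemma vect_unit s : 2%:R != 0 :> K -> is_spin s -> vect s \in unitmx.
Proof.
move=> nz2 sS; apply: (proj2 (mulmx1_unit (A := gram *m (vect s)^T *m gram) _)).
by rewrite -!mulmxA [_^T *m _]mulmxA vect_gram // gramK.
Qed.

End Clifford.

Section Quadric.
Variables (K : fieldType) (m : nat).

Local Notation d := m.+1.
Local Notation N := m.+3.
Local Notation rank := (m.+3)./2.

Implicit Types (X : 'M[K]_N).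

Definition in_so (X : 'M[K]_N) : bool := X^T *m gram K N + gram K N *m X == 0.

(* X is the orbit of the line spanned by the last (lowest weight) basis vector,
   so P_1 and its Lie algebra are the stabilisers of that line; the latter
   contains all lower triangular matrices of so(V). *)
Definition fixes_base_line (A : 'M[K]_N) : bool :=
  [forall i, (i != ord_max) ==> (A i ord_max == 0)].

Definition in_P1 (s : 'M[K]_#|{set 'I_N}|) : Prop :=
  is_spin s /\ fixes_base_line (vect s).

Definition in_p1 (X : 'M[K]_N) : bool := in_so X && fixes_base_line X.

(* The quotient g / p_1 is identified with K^d through tangent_proj, a
   surjection on so(V) with kernel p_1 (tangent_liftK and tangent_proj_ker):
   X |-> (X_(0,1), ..., X_(0,d)).  The j-th basis vector is the class of the
   root vector E_(0,j+1) - E_(rev (j+1),N-1). *)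
Definition mid (j : 'I_d) : 'I_N := lift ord0 (lift ord_max j).

Definition tangent_proj (X : 'M[K]_N) : 'rV[K]_d := \row_j X ord0 (mid j).

Definition tangent_lift (u : 'rV[K]_d) : 'M[K]_N :=
  \sum_j u 0 j *: (delta_mx ord0 (mid j) - delta_mx (rev_ord (mid j)) ord_max).

Lemma mid_inj : injective mid.
Proof. by move=> j k /lift_inj/lift_inj. Qed.

Lemma midP (i : 'I_N) : [\/ i = ord0, i = ord_max | exists j, i = mid j].
Proof.
case: (unliftP ord0 i) => [k ->|->]; last by constructor 1.
case: (unliftP ord_max k) => [j ->|->]; first by constructor 3; exists j.
by constructor 2; apply: val_inj.
Qed.

Lemma mid_neq0 j : (mid j == ord0) = false.
Proof. by []. Qed.

Lemma mid_neqmax j : (mid j == ord_max) = false.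
Proof.
apply/negbTE; rewrite /mid (_ : ord_max = lift ord0 ord_max :> 'I_N).
  by rewrite (inj_eq lift_inj) eq_sym neq_lift.
exact: val_inj.
Qed.

Lemma rev_ord0 : rev_ord (ord0 : 'I_N) = ord_max.
Proof. by apply: val_inj; rewrite /= subn1. Qed.

Lemma rev_max : rev_ord (ord_max : 'I_N) = ord0.
Proof. by rewrite -rev_ord0 rev_ordK. Qed.

Lemma in_soP X :
  reflect (forall i j, X i j = - X (rev_ord j) (rev_ord i)) (in_so X).
Proof.
have E i j : (X^T *m gram K N + gram K N *m X) (rev_ord j) i
           = X (rev_ord i) (rev_ord j) + X j i.
  rewrite !mxE (bigD1 (rev_ord i)) //= big1 ?addr0 => [|k ki]; last first.
    rewrite !mxE (_ : (i == _) = false) ?mulr0 //.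
    by apply: contra_neqF ki => /eqP ->; rewrite rev_ordK.
  rewrite (bigD1 j) //= big1 ?addr0 => [|k kj]; last first.
    by rewrite !mxE rev_ordK (negbTE kj) mul0r.
  by rewrite !mxE !rev_ordK !eqxx mulr1 mul1r.
apply: (iffP eqP) => [X0 i j|soX].
  move/matrixP/(_ (rev_ord i) j): X0; rewrite E mxE => /eqP.
  by rewrite addrC addr_eq0 => /eqP.
apply/matrixP=> i j; rewrite -(rev_ordK i) E [RHS]mxE.
by rewrite [X (rev_ord j) _]soX !rev_ordK addNr.
Qed.

Lemma tangent_lift_so u : in_so (tangent_lift u).
Proof.
apply/in_soP=> i j; rewrite !summxE -sumrN; apply: eq_bigr => k _; rewrite !mxE.
rewrite !(can2_eq (@rev_ordK N) (@rev_ordK N)) rev_ordK rev_ord0 rev_max.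
by rewrite -mulrN opprB [(j == ord_max) && _]andbC [(i == ord0) && _]andbC.
Qed.

Lemma tangent_liftK u : tangent_proj (tangent_lift u) = u.
Proof.
apply/rowP=> k; rewrite !mxE summxE (bigD1 k) //= big1 ?addr0 => [|j jk].
  by rewrite !mxE !eqxx mid_neqmax andbF subr0 mulr1.
by rewrite !mxE mid_neqmax andbF subr0 (inj_eq mid_inj) eq_sym (negbTE jk) mulr0.
Qed.

Lemma tangent_proj_ker X :
  2%:R != 0 :> K -> in_so X -> (tangent_proj X == 0) = in_p1 X.
Proof.
move=> nz2 soX; rewrite /in_p1 soX /=; apply/eqP/forallP => [X0 i|X0].
  apply/implyP; case: (midP i) => [->|->|[j ->]]; rewrite ?eqxx // => _.
    have /eqP := in_soP _ soX ord0 ord_max.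
    rewrite rev_ord0 rev_max -subr_eq0 opprK -mulr2n -mulr_natl.
    by rewrite mulf_eq0 (negbTE nz2).
  rewrite (in_soP _ soX) rev_max oppr_eq0.
  case: (midP (rev_ord (mid j))) => [||[k ->]].
  - by move/(canRL (@rev_ordK N))/eqP; rewrite rev_ord0 mid_neqmax.
  - by move/(canRL (@rev_ordK N))/eqP; rewrite rev_max.
  by move/rowP/(_ k): X0; rewrite !mxE => ->.
apply/rowP=> j; rewrite !mxE (in_soP _ soX) rev_ord0.
have /implyP := X0 (rev_ord (mid j)).
rewrite -{1}rev_ord0 (inj_eq rev_ord_inj) => /(_ isT)/eqP ->.
by rewrite oppr0.
Qed.

Lemma in_p1_lower X :
  in_so X -> (forall i j : 'I_N, (i < j)%N -> X i j = 0) -> in_p1 X.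
Proof.
move=> soX X0; rewrite /in_p1 soX; apply/forallP=> i; apply/implyP=> iN.
by rewrite X0 // ltn_neqAle -ltnS ltn_ord andbT.
Qed.

(* The matrices (acting on row vectors) by which s in P_1 and X in p_1 act on
   g / p_1. *)
Definition tangent_Ad (s : 'M[K]_#|{set 'I_N}|) : 'M[K]_d :=
  lin1_mx (fun u => tangent_proj (vect s *m tangent_lift u *m invmx (vect s))).

Definition tangent_ad (X : 'M[K]_N) : 'M[K]_d :=
  lin1_mx (fun u => tangent_proj (X *m tangent_lift u - tangent_lift u *m X)).

Lemma tangent_proj_is_linear : linear tangent_proj.
Proof. by move=> a X Y; apply/rowP=> j; rewrite !mxE. Qed.
HB.instance Definition _ :=
  GRing.isLinear.Build K 'M[K]_N 'rV[K]_d _ tangent_proj tangent_proj_is_linear.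

Lemma tangent_lift_is_linear : linear tangent_lift.
Proof.
move=> a u v; rewrite /tangent_lift scaler_sumr -big_split /=.
by apply: eq_bigr => j _; rewrite !mxE scalerDl scalerA.
Qed.
HB.instance Definition _ :=
  GRing.isLinear.Build K 'rV[K]_d 'M[K]_N _ tangent_lift tangent_lift_is_linear.

Lemma in_so_sub X Y : in_so X -> in_so Y -> in_so (X - Y).
Proof.
move=> /in_soP soX /in_soP soY; apply/in_soP=> i j; rewrite !mxE soX soY; ring.
Qed.

Lemma tangent_lift_proj X : 2%:R != 0 :> K -> in_so X ->
  in_p1 (X - tangent_lift (tangent_proj X)).
Proof.
move=> nz2 soX; rewrite -tangent_proj_ker //.
  by rewrite linearB /= tangent_liftK subrr.
exact: in_so_sub (tangent_lift_so _).
Qed.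

Lemma in_so_Ad s X : 2%:R != 0 :> K -> is_spin s -> in_so X ->
  in_so (vect s *m X *m invmx (vect s)).
Proof.
move=> nz2 sS /eqP soX; have sU := vect_unit nz2 sS; have sg := vect_gram nz2 sS.
apply/eqP; set A := vect s in sU sg *.
have tU : A^T \in unitmx by rewrite unitmx_tr.
apply: (can_inj (mulKmx tU)); apply: (can_inj (mulmxK sU)).
rewrite mulmx0 mul0mx -[RHS]soX mulmxDr mulmxDl; congr (_ + _).
  rewrite !trmx_mul trmx_inv !mulmxA mulmxV // mul1mx -!mulmxA.
  by congr (_ *m _); rewrite mulmxA sg.
by rewrite !mulmxA sg mulmxKV.
Qed.

Lemma in_p1_Ad s X : 2%:R != 0 :> K -> in_P1 s -> in_p1 X ->
  in_p1 (vect s *m X *m invmx (vect s)).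
Proof.
move=> nz2 [sS sfix] /andP[soX Xfix]; rewrite /in_p1 in_so_Ad //=.
have sU := vect_unit nz2 sS; set A := vect s in sU sfix *.
pose e : 'cV[K]_N := delta_mx ord_max 0.
have fixP (B : 'M[K]_N) :
    fixes_base_line B = (B *m e == B ord_max ord_max *: e).
  rewrite -colE; apply/forallP/eqP => [B0|/colP E i].
    apply/colP=> i; rewrite !mxE eqxx andbT.
    have /implyP := B0 i; case: eqVneq => [-> _|_ /(_ isT)/eqP ->].
      by rewrite mulr1.
    by rewrite mulr0.
  apply/implyP=> iN; move: (E i); rewrite !mxE eqxx andbT (negbTE iN) => ->.
  by rewrite mulr0.
move: sfix Xfix; rewrite !fixP => /eqP Ae /eqP Xe.
set a := A _ _ in Ae.
have a0 : a != 0.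
  apply: contraTneq isT => a0; have : invmx A *m (A *m e) = e by rewrite mulKmx.
  rewrite Ae a0 scale0r mulmx0 => /colP/(_ ord_max).
  by rewrite !mxE !eqxx => /eqP; rewrite eq_sym oner_eq0.
have iAe : invmx A *m e = a^-1 *: e.
  by apply: (scalerI a0); rewrite scalemxAr -Ae mulKmx // scalerA mulfV ?scale1r.
have E : A *m X *m invmx A *m e = X ord_max ord_max *: e.
  rewrite -mulmxA iAe -scalemxAr -mulmxA Xe -scalemxAr Ae !scalerA.
  by rewrite mulrAC mulVf ?mul1r.
rewrite E; apply/eqP; congr (_ *: _).
by move/colP/(_ ord_max): E; rewrite -colE !mxE !eqxx mulr1.
Qed.

Lemma tangent_AdE s X : 2%:R != 0 :> K -> in_P1 s -> in_so X ->
  tangent_proj (vect s *m X *m invmx (vect s)) = tangent_proj X *m tangent_Ad s.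
Proof.
move=> nz2 sP soX; rewrite /tangent_Ad.
pose f := [the {linear _ -> _} of
  tangent_proj \o (mulmxr (invmx (vect s)) \o (mulmx (vect s) \o tangent_lift))].
rewrite -[lin1_mx _]/(lin1_mx f) mul_rV_lin1 /=.
apply/eqP; rewrite -subr_eq0 -linearB /= -mulmxBl -mulmxBr.
have p1X := tangent_lift_proj nz2 soX.
by rewrite tangent_proj_ker ?in_p1_Ad // in_so_Ad //; case: sP; case/andP: p1X.
Qed.

(* The r-th symmetric power of K^d is the space of homogeneous polynomials of
   degree r in the basis vectors of K^d.  A linear map M acts on it by
   substitution, and as an element of a Lie algebra by the derivation extending
   M; both preserve the degree (sym_substE and sym_derE). *)
Definition lin_form (M : 'M[K]_d) (j : 'I_d) : {mpoly K[d]} :=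
  \sum_k M j k *: 'X_k.

Definition sym_subst r (M : 'M[K]_d) (p : dhomog d K r) : dhomog d K r :=
  indhomog r ((p : {mpoly K[d]}) \mPo [tuple lin_form M j | j < d]).

Definition sym_der r (M : 'M[K]_d) (p : dhomog d K r) : dhomog d K r :=
  indhomog r (\sum_j lin_form M j * (p : {mpoly K[d]})^`M(j)).

Lemma lin_form_homog M j : lin_form M j \is 1.-homog.
Proof.
apply: rpred_sum => k _; apply: rpredZ; rewrite dhomogX; apply/eqP; exact: mdeg1.
Qed.

Lemma sym_substE r M (p : dhomog d K r) :
  sym_subst M p = (p : {mpoly K[d]}) \mPo [tuple lin_form M j | j < d]
    :> {mpoly K[d]}.
Proof.
rewrite /sym_subst /indhomog insubdK // [_ \in _]/=.
rewrite comp_mpolyEX big_seq; apply: rpred_sum => mon monp; apply: rpredZ.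
rewrite comp_mpolyX; have <- : mdeg mon = r := dhomog_mf (dhomog_is_dhomog p) monp.
rewrite mdegE.
elim/big_ind2: _ => [|P a Q b|j _]; [exact: dhomog1|exact: dhomogM|].
by rewrite tnth_mktuple; have := dhomogMn (mon j) (lin_form_homog M j); rewrite mul1n.
Qed.

Lemma sym_derE r M (p : dhomog d K r) :
  sym_der M p = \sum_j lin_form M j * (p : {mpoly K[d]})^`M(j)
    :> {mpoly K[d]}.
Proof.
rewrite /sym_der /indhomog insubdK // [_ \in _]/=.
apply: rpred_sum => j _; rewrite [(p : {mpoly K[d]})]mpolyE raddf_sum /=.
rewrite mulr_sumr big_seq; apply: rpred_sum => mon monp.
rewrite linearZ /= -scalerAr; apply: rpredZ; rewrite mderivX -scalerAr.
have [->|mj] := eqVneq (mon j) 0%N; first by rewrite scale0r rpred0.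
apply: rpredZ; have <- : mdeg mon = r := dhomog_mf (dhomog_is_dhomog p) monp.
have -> : mdeg mon = (1 + mdeg (mon - U_(j))%MM)%N.
  rewrite -(mdeg1 j) -mdegD; congr mdeg; apply/mnmP=> k.
  rewrite mnmDE mnmBE mnm1E subnKC //.
  by case: eqVneq => // <-; rewrite lt0n.
apply: dhomogM; first exact: lin_form_homog.
by rewrite dhomogX.
Qed.

Definition SymT r := dhomog d K r.
HB.instance Definition _ r := Vector.on (SymT r).

Definition P1_act r (s : 'M[K]_#|{set 'I_N}|) (w : SymT r) : SymT r :=
  sym_subst (tangent_Ad s) w.

Definition p1_act r (X : 'M[K]_N) (w : SymT r) : SymT r :=
  sym_der (tangent_ad X) w.

Definition P1_stable r (W : {vspace SymT r}) : Prop :=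
  forall s, in_P1 s -> forall w, w \in W -> P1_act s w \in W.

Definition P1_irreducible r (W : {vspace SymT r}) : Prop :=
  [/\ W != 0%VS, P1_stable W
    & forall U : {vspace SymT r},
        P1_stable U -> (U <= W)%VS -> U = 0%VS \/ U = W].

(* Weights are given by their coordinates in the basis eps_k : H |-> H_(k,k) of
   the dual of the Cartan subalgebra of diagonal matrices of so(V). *)
Definition weight : Type := 'rV[K]_rank.

Definition weight_eval (mu : weight) (H : 'M[K]_N) : K :=
  \sum_k mu 0 k * H (inord k) (inord k).

Definition in_cartan (H : 'M[K]_N) : bool := in_so H && is_diag_mx H.

(* The root spaces of the positive roots of the Levi part of P_1 span the
   strictly upper triangular elements of p_1. *)
Definition in_levi_nilp (X : 'M[K]_N) : bool :=
  in_p1 X && [forall i : 'I_N, forall j : 'I_N, (j <= i)%N ==> (X i j == 0)].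

Definition highest_weight_vector r (mu : weight) (w : SymT r) : Prop :=
  [/\ w != 0,
      forall H, in_cartan H -> p1_act H w = weight_eval mu H *: w
    & forall X, in_levi_nilp X -> p1_act X w = 0].

(* W realises the irreducible P_1-module E_mu, which is determined by mu up to
   isomorphism. *)
Definition is_E r (mu : weight) (W : {vspace SymT r}) : Prop :=
  P1_irreducible W /\ (exists2 w, w \in W & highest_weight_vector mu w).

(* Simple roots and fundamental weights in Bourbaki's order, numbered from 1:
   type B_rank if N is odd and type D_rank if N is even. *)
Definition eps (k : nat) : weight := \row_(l < rank) (l.+1 == k)%:R.

Definition simple_root (j : nat) : weight :=
  if (j < rank)%N then eps j - eps j.+1
  else if odd N then eps rank else eps rank.-1 + eps rank.

Definition fund_weight (i : nat) : weight :=
  if i == rank then 2%:R^-1 *: \sum_(1 <= k < rank.+1) eps k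
  else if ~~ odd N && (i == rank.-1)
    then 2%:R^-1 *: (\sum_(1 <= k < rank) eps k - eps rank)
  else \sum_(1 <= k < i.+1) eps k.

Definition wdot (mu nu : weight) : K := \sum_k mu 0 k * nu 0 k.

Definition coroot_pairing (mu alpha : weight) : K :=
  2%:R * wdot mu alpha / wdot alpha alpha.

Lemma wdot_eps mu (k : nat) : (0 < k <= rank)%N ->
  wdot mu (eps k) = mu 0 (inord k.-1).
Proof.
case/andP=> k0 kr; rewrite /wdot (bigD1 (inord k.-1)) //= big1 ?addr0.
  by rewrite mxE inordK prednK ?eqxx ?mulr1.
move=> l lk; rewrite mxE (_ : l.+1 == k = false) ?mulr0 //.
by apply: contra_neqF lk => /eqP <-; rewrite inord_val.
Qed.

Lemma sum_eps (b : nat) l :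
  (\sum_(1 <= k < b) eps k) 0 l = (l.+1 < b)%N%:R.
Proof.
rewrite summxE; case: ltnP => lb.
  rewrite (bigD1_seq l.+1) ?iota_uniq ?mem_index_iota //= big1 ?addr0.
    by rewrite mxE eqxx.
  by move=> k kl; rewrite mxE eq_sym (negbTE kl).
rewrite big_nat big1 // => k /andP[_ kb]; rewrite mxE.
by case: eqP => // kl; move: (leq_trans kb lb); rewrite kl ltnn.
Qed.

Lemma wdotBr mu x y : wdot mu (x - y) = wdot mu x - wdot mu y.
Proof. by rewrite -sumrB; apply: eq_bigr => k _; rewrite !mxE mulrBr. Qed.

Lemma wdotDr mu x y : wdot mu (x + y) = wdot mu x + wdot mu y.
Proof. by rewrite -big_split; apply: eq_bigr => k _; rewrite !mxE mulrDr. Qed.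

End Quadric.

Lemma fund_weightP (K : numFieldType) m (i j : nat) : (3 <= m.+1)%N ->
  (0 < i <= (m.+3)./2)%N -> (0 < j <= (m.+3)./2)%N ->
  coroot_pairing (fund_weight K m i) (simple_root K m j) = (i == j)%:R.
Proof.
move=> m3; set n := (m.+3)./2 => i_n j_n.
have nn : n = (m.+1)./2.+1 by [].
have n2 : (1 < n)%N by rewrite nn ltnS half_gt0 ltnW.
have E k l : (0 < k <= n)%N -> (0 < l <= n)%N ->
    wdot (eps K m k) (eps K m l) = (k == l)%:R.
  move=> kn /[dup] ln /andP[l0 lr]; rewrite wdot_eps // mxE inordK ?prednK //.
  by rewrite eq_sym.
have F k : (0 < k <= n)%N -> wdot (fund_weight K m i) (eps K m k) =
    if i == n then 2^-1
    else if ~~ odd m.+3 && (i == n.-1) then (if k == n then - 2^-1 else 2^-1)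
    else (k <= i)%N%:R.
  move=> /[dup] kn /andP[k0 kr]; rewrite wdot_eps // /fund_weight -/n.
  have kE : (inord k.-1 : 'I_n).+1 = k by rewrite inordK prednK.
  case: ifP => _; first by rewrite mxE sum_eps kE ltnS kr mulr1.
  case: ifP => _; last by rewrite sum_eps kE ltnS.
  rewrite !mxE sum_eps kE ltn_neqAle kr andbT.
  by case: eqVneq => _ /=; rewrite ?sub0r ?subr0 ?mulrN mulr1.
have [i0 ir] := andP i_n; have [j0 jr] := andP j_n.
have B (x y : weight K m) c : wdot x x = 1 -> wdot y y = 1 -> wdot x y = 0 ->
    c ^+ 2 = 1 -> wdot (x + c *: y) (x + c *: y) = 2.
  move=> xx yy xy c2.
  have -> : wdot (x + c *: y) (x + c *: y)
          = wdot x x + 2 * c * wdot x y + c ^+ 2 * wdot y y.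
    rewrite /wdot !mulr_sumr -!big_split /=.
    by apply: eq_bigr => l _; rewrite !mxE; ring.
  by rewrite xx yy xy c2 mulr0 addr0 mulr1.
have two : (2 : K) != 0 by rewrite pnatr_eq0.
rewrite /coroot_pairing /simple_root -/n; case: ltnP => [jn|nj].
  have jj : (0 < j.+1 <= n)%N by [].
  rewrite -scaleN1r B ?E ?eqxx ?sqrrN ?expr1n //; last first.
    by rewrite (ltn_eqF (ltnSn j)).
  rewrite mulrAC divff // mul1r scaleN1r wdotBr !F //.
  case: (eqVneq i n) => [->|ni]; first by rewrite subrr gtn_eqF.
  case: ifP => [/andP[_ /eqP ->]|_].
    have -> : (n.-1 == j) = (j.+1 == n) by rewrite nn eqSS eq_sym.
    rewrite (ltn_eqF jn).
    by case: eqVneq => _ /=; [field | rewrite subrr].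
  by case: ltngtP => _; rewrite ?subrr ?subr0.
have -> : j = n by apply/eqP; rewrite eqn_leq jr nj.
have nn0 : (0 < n <= n)%N by rewrite leqnn andbT nn.
case: ifPn => oddm.
  rewrite E // eqxx divr1 F //; case: (eqVneq i n) => [_|ni].
    by rewrite mulfV.
  by rewrite oddm /= leqNgt ltn_neqAle ni ir mulr0.
have n1 : (0 < n.-1 <= n)%N by rewrite leq_pred -ltnS prednK ?n2 // nn.
have nP : n.-1 != n by rewrite nn /= ltn_eqF.
rewrite -[eps K m n]scale1r B ?E ?eqxx ?(negbTE nP) ?expr1n // scale1r.
rewrite mulrAC divff // mul1r wdotDr !F // oddm.
case: (eqVneq i n) => [_|ni]; first by rewrite /=; field.
case: (eqVneq i n.-1) => [ni1|ni1] /=; first by rewrite (negbTE nP) eqxx subrr.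
have lin : (i < n)%N by rewrite ltn_neqAle ni.
have lin1 : (i < n.-1)%N by rewrite ltn_neqAle ni1 -ltnS (ltn_predK n2).
by rewrite [(n <= i)%N]leqNgt lin [(n.-1 <= i)%N]leqNgt lin1 addr0.
Qed.

(* Main.v *)
Require Import Defs.
From HB Require Import structures.
From mathcomp Require Import all_boot all_order all_algebra.
From mathcomp Require Import reals complex mpoly ring.

Set Implicit Arguments.
Unset Strict Implicit.
Unset Printing Implicit Defensive.

Import Order.TTheory GRing.Theory Num.Theory.
Local Open Scope ring_scope.

(** Elements of P_1 act on g / p_1 by similitudes of the quadratic form
    q = \sum_j X_j X_(rev j): the unipotent radical acts trivially, and the
    Levi part is, up to scalars, a special orthogonal group.  So Sym^r T_X is
    the space of forms of degree r on a quadratic space of dimension d >= 3,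
    and its decomposition is that of the theory of spherical harmonics,

      Sym^r = \bigoplus_i q^i H_(r - 2 i),   H_k = ker laplacian in degree k.

    The sum is full and direct because the Laplacian maps q^(i+1) h to a nonzero
    multiple of q^i h when h is harmonic (laplacian_quadX), which allows an
    induction on r (harmonic_exists, harmonic_unique).  A similitude maps q to
    a multiple of q and commutes with the Laplacian up to a scalar, hence
    preserves q^i H_(r - 2 i) (component_stable).  The vector
    q^i X_max^(r - 2 i) is killed by the upper triangular part of p_1, and has
    weight (r - 2 i)(eps_1 + eps_2) + 2 i eps_1 since the Cartan subalgebra acts
    by derivations with q of weight 2 eps_1 and X_max of weight eps_1 + eps_2
    (highest_weight_hw); fund_weight_comb rewrites that weight in terms of the
    fundamental weights, which is where Q^3 and Q^4 are special.

    What remains is the irreducibility of H_k.  P_1 contains lifts of all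
    products of two reflections of the quadratic space (spin_refl), and these
    suffice.  Let W be a nonzero subspace of H_k that they preserve.
    - A form vanishing on the part X_0 <> 0 of the isotropic cone is divisible
      by q (cone_vanish), and a harmonic multiple of q is zero.  So some u in W
      is nonzero at an isotropic vector, which a product of two reflections
      moves to the last basis vector: X_max^k occurs in some element of W.
    - X_max^k is the only monomial of top weight for the torus that scales
      X_max and X_0 inversely, so it belongs to W (top_form_mem), and with it
      the powers l^k of the isotropic linear forms l = \sum_j w_j X_j with w_0 <> 0
      (isotropic_power_mem).
    - Let phi be a linear functional that kills W and q Sym^(k-2).  The
      polynomial F(y) = \sum_l phi(x^l) y^l / l! over the monomials x^l of
      degree k is harmonic, because phi kills the multiples of q
      (genfun_laplacian), and k! F(w) = phi((\sum_j w_j X_j)^k)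
      (meval_genfun), so F vanishes on the cone.  Hence F = 0 and phi = 0.
      This proves that W + q Sym^(k-2) is everything, and therefore that W
      contains H_k (harmonic_mem). *)

(** * Polynomials in several variables *)

Section Multivariate.
Variables (K : numFieldType) (n : nat).
Local Notation A := {mpoly K[n]}.
Implicit Types p f g : A.

Lemma digits_inj k B (a b : 'I_k -> nat) :
  (forall i, a i < B)%N -> (forall i, b i < B)%N ->
  (\sum_i a i * B ^ i = \sum_i b i * B ^ i)%N -> a =1 b.
Proof.
elim: k a b => [|k IHk] a b aB bB; first by move=> _ [].
rewrite !big_ord_recl /= !expn0 !muln1 => E.
have shift c : (\sum_(i < k) c (lift ord0 i) * B ^ bump 0 i
    = (\sum_(i < k) c (lift ord0 i) * B ^ i) * B)%N.
  rewrite big_distrl /=; apply: eq_bigr => i _.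
  by rewrite /bump /= add1n expnSr mulnA.
rewrite !shift in E; have B0 : (0 < B)%N by apply: leq_ltn_trans (aB ord0).
have E0 : a ord0 = b ord0.
  by have := congr1 (modn^~ B) E; rewrite /= ![(_ + _ * B)%N]addnC !modnMDl !modn_small.
move: E; rewrite E0 => /addnI/eqP; rewrite eqn_pmul2r // => /eqP E1.
move=> i; case: (unliftP ord0 i) => [j ->|-> //].
exact: IHk (fun i => aB (lift ord0 i)) (fun i => bB (lift ord0 i)) E1 j.
Qed.

Lemma poly_eq0_of_horner (p : {poly K}) : (forall c, c != 0 -> p.[c] = 0) -> p = 0.
Proof.
move=> p0; apply: contraTeq isT => pn0.
pose s : seq K := [seq i.+1%:R | i <- iota 0 (size p)].
have us : uniq s.
  rewrite map_inj_in_uniq ?iota_uniq // => i j _ _ /eqP.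
  by rewrite eqr_nat eqSS => /eqP.
have rs : all (root p) s.
  by apply/allP=> _ /mapP[i _ ->]; rewrite /root p0 ?pnatr_eq0.
by have := max_poly_roots pn0 rs us; rewrite size_map size_iota ltnn.
Qed.

(** Kronecker substitution: the substitution of c^(B^i) for the i-th variable,
    with B larger than the degrees, sends distinct monomials to distinct
    powers of c, which reduces the claim to one variable. *)
Lemma mpoly_eq0_of_meval p : (forall v, p.@[v] = 0) -> p = 0.
Proof.
move=> p0; pose B := msize p.
pose N (m : 'X_{1..n}) := (\sum_i m i * B ^ i)%N.
pose P : {poly K} := \sum_(m <- msupp p) p@_m *: 'X^(N m).
have P0 : P = 0.
  apply: poly_eq0_of_horner => c _; rewrite -(p0 (fun i => c ^+ (B ^ i))) mevalE.
  rewrite horner_sum; apply: eq_bigr => m _; rewrite hornerZ hornerXn.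
  congr (_ * _); rewrite /N -prodrXr; apply: eq_bigr => i _.
  by rewrite mulnC exprM.
apply/mpolyP=> m; rewrite mcoeff0.
have [mp|] := boolP (m \in msupp p); last exact: memN_msupp_eq0.
have mB i k : k \in msupp p -> (k i < B)%N.
  move=> kp; apply: leq_ltn_trans (msize_mdeg_lt kp).
  by rewrite mdegE (bigD1 i) //= leq_addr.
have := congr1 (fun P : {poly K} => P`_(N m)) P0; rewrite coef0 coef_sum.
rewrite (bigD1_seq m) ?msupp_uniq //= coefZ coefXn eqxx mulr1.
rewrite big1_seq ?addr0 // => k /andP[km kp]; rewrite coefZ coefXn.
rewrite (_ : (_ == _) = false) ?mulr0 //; apply: contra_neqF km => /eqP E.
by apply/mnmP; apply/digits_inj/esym/E => i; apply: mB.
Qed.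

Lemma mpoly_sum_ind (Q : A -> Prop) :
  (forall m, Q 'X_[m]) -> (forall c p g, Q p -> Q g -> Q (c *: p + g)) ->
  forall p, Q p.
Proof.
move=> QX QD.
have Q0 : Q 0.
  by have := QD (-1) _ _ (QX 0%MM) (QX 0%MM); rewrite scaleN1r addNr.
by elim/mpolyind => // c m p _ _ Qp; apply: QD.
Qed.

(** Substitution respects congruences modulo a principal ideal. *)
Lemma comp_mpoly_congr k (a b : n.-tuple {mpoly K[k]}) (c : {mpoly K[k]}) :
  (forall i, exists e, tnth a i - tnth b i = c * e) ->
  forall p, exists e, (p \mPo a) - (p \mPo b) = c * e.
Proof.
move=> ab; apply: mpoly_sum_ind => [m|z p g [e ep] [e' eg]]; last first.
  exists (z *: e + e'); rewrite !comp_mpolyD !comp_mpolyZ mulrDr -scalerAr.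
  by rewrite -ep -eg scalerBr opprD addrACA.
rewrite !comp_mpolyX; apply: (big_rec2 (fun x y => exists e, x - y = c * e)).
  by exists 0; rewrite subrr mulr0.
move=> i y x _ [e yx].
have [e' E'] : exists e', tnth a i ^+ m i - tnth b i ^+ m i = c * e'.
  have [e0 e0E] := ab i.
  by rewrite subrXX e0E -mulrA; eexists.
exists (tnth a i ^+ m i * e + e' * x).
set u := _ ^+ _ in E' *; set v := _ ^+ _ in E' *.
have -> : c * (u * e + e' * x) = u * (c * e) + c * e' * x by ring.
by rewrite -yx -E'; ring.
Qed.

Lemma comp_mpoly_scaled k (c : A) p : p \is k.-homog ->
  p \mPo [tuple c * 'X_i | i < n] = c ^+ k * p.
Proof.
move=> hp; rewrite comp_mpolyEX [in RHS](mpolyE p) mulr_sumr.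
apply: eq_big_seq => m mp; rewrite -scalerAr comp_mpolyX; congr (_ *: _).
have <- : mdeg m = k := dhomog_mf hp mp.
rewrite mpolyXE_id mdegE -prodrXr -big_split /=.
by apply: eq_bigr => i _; rewrite tnth_mktuple exprMn.
Qed.

Lemma deriv_homog k p j : p \is k.+1.-homog -> p^`M(j) \is k.-homog.
Proof.
move=> hp; apply/dhomogP=> m; rewrite mcoeff_msupp mcoeff_deriv => mp.
have: p@_(m + U_(j)) != 0 by apply: contraNneq mp => ->; rewrite mul0rn.
rewrite -mcoeff_msupp => /(dhomog_mf hp).
by rewrite /= mdegD mdeg1 addn1 => -[].
Qed.

Lemma deriv_homog0 p j : p \is 0.-homog -> p^`M(j) = 0.
Proof.
move=> hp; apply/mpolyP=> m; rewrite mcoeff_deriv mcoeff0.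
by rewrite (dhomog_nemf_coeff hp) ?mul0rn //= mdegD mdeg1 addn1.
Qed.

Lemma euler k p : p \is k.-homog -> \sum_j 'X_j * p^`M(j) = k%:R *: p.
Proof.
move=> hp; apply/mpolyP=> m; rewrite mcoeffZ raddf_sum /=.
have E j : ('X_j * p^`M(j))@_m = (m j)%:R * p@_m.
  rewrite mulrC; have [mj|mj] := eqVneq (m j) 0%N.
    rewrite mj mul0r mcoeffMr big1 // => -[k1 k2] /= /eqP mE.
    rewrite mcoeffX (_ : _ == _ = false) ?mulr0 //; apply/negP=> /eqP jk.
    by move: mj; rewrite mE -jk mnmDE mnm1E eqxx /=.
  have -> : m = (U_(j) + (m - U_(j)))%MM.
    apply/mnmP=> i; rewrite mnmDE mnmBE mnm1E; case: eqVneq => [<-|_] /=.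
      by rewrite subnKC // lt0n.
    by rewrite add0n subn0.
  rewrite mcoeffMX mcoeff_deriv mnmDE mnm1E eqxx add1n.
  by rewrite addmC mulr_natl.
rewrite (eq_bigr _ (fun j _ => E j)) -mulr_suml -natr_sum -mdegE.
have [->|mp] := eqVneq p@_m 0; first by rewrite !mulr0.
by rewrite (dhomog_mf hp) // mcoeff_msupp.
Qed.
End Multivariate.

(** * Harmonic polynomials *)

Section Harmonic.
Variables (K : numFieldType) (m : nat).
Local Notation n := m.+1.
Local Notation A := {mpoly K[n]}.
Implicit Types p f g h : A.

Definition quad : A := \sum_j 'X_j * 'X_(rev_ord j).

Definition laplacian p : A := \sum_j (p^`M(j))^`M(rev_ord j).

Definition harmonic k p : bool := (p \is k.-homog) && (laplacian p == 0).

Lemma laplacian_is_linear : linear laplacian.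
Proof.
move=> a p g; rewrite /laplacian scaler_sumr -big_split /=.
by apply: eq_bigr => j _; rewrite !linearP.
Qed.
HB.instance Definition _ :=
  GRing.isLinear.Build K A A _ laplacian laplacian_is_linear.

Lemma mderiv_var i j : ('X_i : A)^`M(j) = (i == j)%:R.
Proof.
rewrite mderivX mnm1E; case: eqVneq => [->|_]; last by rewrite scale0r.
rewrite scale1r -mpolyX0; congr mpolyX.
by apply/mnmP=> l; rewrite mnmBE subnn mnm0E.
Qed.

Lemma quad_homog : quad \is 2.-homog.
Proof.
apply: rpred_sum => j _; rewrite -mpolyXD dhomogX; apply/eqP.
by rewrite /= mdegD !mdeg1.
Qed.

Lemma quadX_homog i k p : p \is k.-homog -> quad ^+ i * p \is (2 * i + k).-homog.
Proof. by move=> hp; apply: dhomogM => //; apply: dhomogMn quad_homog. Qed.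

Lemma mderiv_quad j : quad^`M(j) = 'X_(rev_ord j) *+ 2.
Proof.
rewrite /quad raddf_sum /=.
under eq_bigr => i _ do rewrite mderivM !mderiv_var.
rewrite big_split /= (bigD1 j) //= eqxx mul1r big1 => [|i /negbTE ->]; last first.
  by rewrite mul0r.
rewrite (bigD1 (rev_ord j)) //= rev_ordK eqxx mulr1 big1 ?addr0 ?mulr2n // => i ij.
rewrite (_ : rev_ord i == j = false) ?mulr0 //.
by apply: contra_neqF ij => /eqP <-; rewrite rev_ordK.
Qed.

(** This is the commutation relation of the sl_2-triple formed by q, the
    Laplacian and the Euler operator. *)
Lemma laplacian_quadM k p : p \is k.-homog ->
  laplacian (quad * p) = quad * laplacian p + (2 * n + 4 * k)%:R *: p.
Proof.
move=> hp.
have E j : (quad * p)^`M(j)^`M(rev_ord j)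
    = quad * p^`M(j)^`M(rev_ord j) + (2 * p + 2 * ('X_j * p^`M(j))
      + 2 * ('X_(rev_ord j) * p^`M(rev_ord j))).
  rewrite mderivM mderivD !mderivM !mderiv_quad raddfMn /= mderiv_var eqxx.
  by rewrite rev_ordK /=; ring.
rewrite /laplacian (eq_bigr _ (fun j _ => E j)) !big_split /= -!mulr_sumr.
congr (_ + _); rewrite sumr_const card_ord.
have -> : \sum_j 'X_(rev_ord j) * p^`M(rev_ord j) = \sum_j 'X_j * p^`M(j).
  by rewrite [RHS](reindex_inj rev_ord_inj).
rewrite (euler hp).
by rewrite !scaler_nat -mulr_natr -[p *+ (_ + _)]mulr_natr -[p *+ k]mulr_natr; ring.
Qed.

Lemma laplacian_quadX i k h : harmonic k h ->
  laplacian (quad ^+ i.+1 * h)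
    = (2 * i.+1 * (n + 2 * k + 2 * i))%:R *: (quad ^+ i * h).
Proof.
case/andP=> hk /eqP h0; elim: i => [|i IHi].
  rewrite expr1 expr0 mul1r (laplacian_quadM hk) h0 mulr0 add0r.
  by congr (_%:R *: _); ring.
rewrite exprS -mulrA (laplacian_quadM (quadX_homog _ hk)) IHi -scalerAr mulrA.
by rewrite -exprS -scalerDl -natrD; congr (_%:R *: _); ring.
Qed.

Lemma laplacian_homog k p : p \is k.+2.-homog -> laplacian p \is k.-homog.
Proof. by move=> hp; apply: rpred_sum => j _; do 2!apply: deriv_homog. Qed.

Lemma laplacian_low k p : (k < 2)%N -> p \is k.-homog -> laplacian p = 0.
Proof.
move=> k2 hp; rewrite /laplacian big1 // => j _.
case: k k2 hp => [|[|//]] _ hp; first by rewrite (deriv_homog0 _ hp) raddf0.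
by apply: deriv_homog0; apply: deriv_homog.
Qed.

Lemma harmonicZ k c h : harmonic k h -> harmonic k (c *: h).
Proof.
by case/andP=> hk /eqP h0; rewrite /harmonic rpredZ // linearZ /= h0 scaler0 eqxx.
Qed.

(** Decompose the Laplacian of p by induction and lift each term along
    laplacian_quadX; what is left of p is harmonic. *)
Lemma harmonic_exists r p : p \is r.-homog -> exists2 h : nat -> A,
  forall i, (2 * i <= r)%N -> harmonic (r - 2 * i) (h i)
  & p = \sum_(i < r./2.+1) quad ^+ i * h i.
Proof.
have [N] := ubnP r; elim: N r p => // N IHr [|[|r]] p rN hp.
- exists (fun=> p); last by rewrite big_ord1 expr0 mul1r.
  by case=> [_|i]; [rewrite /harmonic hp (laplacian_low _ hp) ?eqxx | rewrite mulnS].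
- exists (fun=> p); last by rewrite big_ord1 expr0 mul1r.
  by case=> [_|i]; [rewrite /harmonic hp (laplacian_low _ hp) ?eqxx | rewrite mulnS].
have [h hh lapE] := IHr r _ (ltnW rN) (laplacian_homog hp).
pose c i : K := (2 * i.+1 * (n + 2 * (r - 2 * i) + 2 * i))%:R.
have c0 i : c i != 0 by rewrite pnatr_eq0.
pose g := \sum_(i < r./2.+1) quad ^+ i.+1 * ((c i)^-1 *: h i).
have r2 (i : 'I_(r./2.+1)) : (2 * i <= r)%N.
  by rewrite mul2n -geq_half_double -ltnS.
have lapg : laplacian g = laplacian p.
  rewrite lapE /g raddf_sum /=; apply: eq_bigr => i _.
  rewrite (laplacian_quadX i (harmonicZ _ (hh _ (r2 i)))) -/(c i) -scalerAr scalerA.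
  by rewrite divff // scale1r.
exists (fun i => if i is j.+1 then (c j)^-1 *: h j else p - g).
  case=> [|i] ir; last first.
    rewrite (_ : r.+2 - 2 * i.+1 = r - 2 * i)%N ?mulnS //.
    by apply/harmonicZ/hh; rewrite mulnS in ir.
  rewrite muln0 subn0 /harmonic linearB /= lapg subrr eqxx andbT.
  apply: rpredB => //; apply: rpred_sum => i _; rewrite -scalerAr; apply: rpredZ.
  have /andP[hi _] := hh _ (r2 i).
  have := quadX_homog i.+1 hi; rewrite mulnS -addnA subnKC //.
by rewrite big_ord_recl expr0 mul1r subrK.
Qed.

(** Applying the Laplacian to the relation removes h_0 and leaves, in degree
    r - 2, a relation between nonzero multiples of the h_(i+1). *)
Lemma harmonic_unique r (h : nat -> A) :
  (forall i, (2 * i <= r)%N -> harmonic (r - 2 * i) (h i)) ->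
  \sum_(i < r./2.+1) quad ^+ i * h i = 0 ->
  forall i, (2 * i <= r)%N -> h i = 0.
Proof.
have [N] := ubnP r; elim: N r h => // N IHr [|[|r]] h rN hh.
- by rewrite big_ord1 mul1r => h0 [].
- by rewrite big_ord1 mul1r => h0 [|[]].
rewrite big_ord_recl expr0 mul1r => hsum.
pose c i : K := (2 * i.+1 * (n + 2 * (r - 2 * i) + 2 * i))%:R.
have c0 i : c i != 0 by rewrite pnatr_eq0.
have hh' i : (2 * i <= r)%N -> harmonic (r - 2 * i) (h i.+1).
  by move=> ir; have := hh i.+1; rewrite mulnS; apply.
have r2 (i : 'I_(r./2.+1)) : (2 * i <= r)%N.
  by rewrite mul2n -geq_half_double -ltnS.
have h0 i : (2 * i <= r)%N -> h i.+1 = 0.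
  move=> ir; apply: (scalerI (c0 i)); rewrite scaler0.
  apply: (IHr r (fun j => c j *: h j.+1) (ltnW rN)) => // [j jr|].
    exact/harmonicZ/hh'.
  have /andP[_ /eqP lap0] := hh 0%N isT.
  have := congr1 laplacian hsum; rewrite raddf0 raddfD /= lap0 add0r raddf_sum /=.
  move=> {2}<-; apply: eq_bigr => j _.
  by rewrite (laplacian_quadX j (hh' _ (r2 j))) -scalerAr.
case=> [_|i ir]; last by apply: h0; rewrite mulnS in ir.
move: hsum; rewrite big1 ?addr0 // => i _; rewrite lift0 h0 ?mulr0 //.
Qed.
End Harmonic.

(** * Forms vanishing on the isotropic cone *)

Section Bilinear.
Variables (K : fieldType) (n : nat).
Implicit Types u v w : 'cV[K]_n.

Lemma bilDl u v w : bil (u + v) w = bil u w + bil v w.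
Proof. by rewrite /bil -big_split /=; apply: eq_bigr => i _; rewrite mxE mulrDl. Qed.

Lemma bilZl a v w : bil (a *: v) w = a * bil v w.
Proof. by rewrite /bil mulr_sumr; apply: eq_bigr => i _; rewrite mxE mulrA. Qed.

Lemma bilDr u v w : bil w (u + v) = bil w u + bil w v.
Proof. by rewrite !(bilC w) bilDl. Qed.

Lemma bilZr a v w : bil w (a *: v) = a * bil w v.
Proof. by rewrite !(bilC w) bilZl. Qed.

Lemma bilBl u v w : bil (u - v) w = bil u w - bil v w.
Proof. by rewrite -scaleN1r bilDl bilZl mulN1r. Qed.

Lemma bilBr u v w : bil w (u - v) = bil w u - bil w v.
Proof. by rewrite !(bilC w) bilBl. Qed.

Lemma bil_delta v i : bil v (delta_mx i 0) = v (rev_ord i) 0.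
Proof.
rewrite /bil (bigD1 (rev_ord i)) //= big1 ?addr0 => [|j ji].
  by rewrite mxE rev_ordK !eqxx mulr1.
rewrite mxE (_ : rev_ord j == i = false) ?mulr0 //.
by apply: contra_neqF ji => /eqP <-; rewrite rev_ordK.
Qed.

End Bilinear.

Section Cone.
Variables (K : numFieldType) (m : nat).
Local Notation n := m.+1.
Local Notation A := {mpoly K[n]}.
Local Notation quad := (quad K m).
Local Notation X0 := ('X_ord0 : A).
Implicit Types (p f g F : A) (v w : 'cV[K]_n).

Lemma meval_quad w : quad.@[fun i => w i 0] = bil w w.
Proof. by rewrite raddf_sum /=; apply: eq_bigr => i _; rewrite mevalM !mevalXU. Qed.

(** Since F is homogeneous, g may be replaced by its component of degree
    k - 2. *)
Lemma homog_quad_quotient k F g : F \is k.-homog -> F = quad * g ->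
  exists2 g', g' \is (k - 2).-homog & F = quad * g'.
Proof.
move=> hF FE; pose gd d := pihomog mdeg d g.
exists (if (1 < k)%N then gd (k - 2)%N else 0).
  by case: ifP => _; [apply: pihomogP | apply: rpred0].
have hg d : quad * gd d \is (2 + d).-homog.
  by apply: dhomogM (quad_homog _ _) _; apply: pihomogP.
have -> : F = \sum_(d < msize g + k) pihomog mdeg k (quad * gd d).
  rewrite -raddf_sum /= -mulr_sumr -pihomog_partitionE ?leq_addr // -FE.
  by rewrite pihomog_dE.
have E d : pihomog mdeg k (quad * gd d) = if (2 + d)%N == k then quad * gd d else 0.
  case: ifP => [/eqP <-|/negbT dk]; first by rewrite pihomog_dE.
  by rewrite (pihomog_ne0 dk).
under eq_bigr => d _ do rewrite E.
case: ifP => k2; last first.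
  rewrite mulr0 big1 // => d _; case: eqP => // dk.
  by rewrite -dk in k2.
have kg : (k - 2 < msize g + k)%N.
  by rewrite (leq_trans _ (leq_addl _ _)) // -subSn // leq_subLR addnC addn2 ltnW.
rewrite (bigD1 (Ordinal kg)) //= subnKC // eqxx big1 ?addr0 // => d dk.
case: eqP => // E'; case/eqP: dk; apply/val_inj/esym/eqP.
by rewrite /= -(eqn_add2l 2) subnKC // eq_sym E'.
Qed.

(** If F = q g and g = \sum_i q^i h_i with h_i harmonic, then the Laplacian of F
    is \sum_i c_i q^i h_i with all c_i nonzero, so every h_i vanishes. *)
Lemma harmonic_quad_multiple k F g : harmonic k F -> F = quad * g -> F = 0.
Proof.
case/andP=> hF /eqP F0 FE; have [{FE} g' hg FE] := homog_quad_quotient hF FE.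
rewrite FE; have [h hh gE] := harmonic_exists hg; set r := (k - 2)%N in hg hh gE *.
pose c i : K := (2 * i.+1 * (n + 2 * (r - 2 * i) + 2 * i))%:R.
have c0 i : c i != 0 by rewrite pnatr_eq0.
have r2 (i : 'I_(r./2.+1)) : (2 * i <= r)%N.
  by rewrite mul2n -geq_half_double -ltnS.
suff h0 i : (2 * i <= r)%N -> h i = 0.
  by rewrite gE big1 ?mulr0 // => i _; rewrite h0 ?mulr0.
move=> ir; apply: (scalerI (c0 i)); rewrite scaler0.
apply: (harmonic_unique (h := fun i => c i *: h i)) ir => [j jr|].
  exact/harmonicZ/hh.
move: F0; rewrite FE gE mulr_sumr raddf_sum /= => {2}<-; apply: eq_bigr => j _.
by rewrite mulrA -exprS (laplacian_quadX j (hh _ (r2 j))) -scalerAr.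
Qed.

Hypothesis m2 : (2 <= m)%N.

Lemma ord0_neq_max : (ord0 == ord_max :> 'I_n) = false.
Proof. by rewrite -val_eqE /= ltn_eqF // (leq_trans _ m2). Qed.

Lemma rev0 : rev_ord (ord0 : 'I_n) = ord_max.
Proof. by apply: val_inj; rewrite /= subn1. Qed.

Lemma revmax : rev_ord (ord_max : 'I_n) = ord0.
Proof. by rewrite -rev0 rev_ordK. Qed.

Definition ord_one : 'I_n := Ordinal (leq_trans m2 (leqnSn m)).

Definition evec i : 'cV[K]_n := delta_mx i 0.

Lemma rev_one_neq :
  (rev_ord ord_one == ord0) = false /\ (rev_ord ord_one == ord_max) = false.
Proof.
split; rewrite -val_eqE /= subSS.
  by rewrite subn_eq0 leqNgt m2.
by rewrite ltn_eqF // subn1 prednK // ltnW.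
Qed.

(** An anisotropic vector orthogonal to the hyperbolic pair of the first and
    last basis vectors; its existence needs dimension at least 3.  The
    reflection in it corrects the parity of the number of reflections. *)
Definition midvec : 'cV[K]_n := evec ord_one + evec (rev_ord ord_one).

Lemma midvec0 : midvec ord0 0 = 0.
Proof.
by rewrite !mxE [ord0 == rev_ord _]eq_sym; case: rev_one_neq => -> _; rewrite addr0.
Qed.

Lemma midvec_max : midvec ord_max 0 = 0.
Proof.
rewrite !mxE [ord_max == rev_ord _]eq_sym; case: rev_one_neq => _ ->; rewrite addr0.
by rewrite -val_eqE /= gtn_eqF.
Qed.

Lemma bil_midvec : bil midvec midvec != 0.
Proof.
rewrite /midvec bilDr !bil_delta rev_ordK !mxE !eqxx -!natrD pnatr_eq0.
by rewrite !addn_eq0 andbF.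
Qed.

Lemma X0_neq0 : X0 != 0.
Proof.
apply/eqP=> /(congr1 (meval (fun=> 1))); rewrite mevalXU meval0.
by apply/eqP; rewrite oner_eq0.
Qed.

(** X_0 and q are coprime: when X_0 = 0 the form q takes the nonzero value
    bil midvec midvec, so e vanishes at X_0 = 0 and is divisible by X_0. *)
Lemma X0_cancel f e : X0 * f = quad * e -> exists g, f = quad * g.
Proof.
move=> E; pose z : n.-tuple A := [tuple if i == ord0 then 0 else 'X_i | i < n].
have qz0 : quad \mPo z != 0.
  apply/eqP=> /(congr1 (meval (fun i => midvec i 0))) /eqP.
  rewrite comp_mpoly_meval meval0; apply/negP.
  rewrite (meval_eq (v2 := fun i => midvec i 0)) ?meval_quad ?bil_midvec // => i.
  rewrite tnth_mktuple; case: eqP => [->|_]; last by rewrite mevalXU.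
  by rewrite meval0 midvec0.
have ez0 : e \mPo z = 0.
  apply: (mulfI qz0); rewrite -rmorphM /= -E rmorphM /= comp_mpolyXU.
  by rewrite -tnth_nth tnth_mktuple mul0r mulr0.
have [i|e' ee'] := @comp_mpoly_congr K n n [tuple 'X_i | i < n] z X0 _ e.
  rewrite !tnth_mktuple; case: eqP => [->|_]; last by exists 0; rewrite subrr mulr0.
  by exists 1; rewrite subr0 mulr1.
exists e'; apply: (mulfI X0_neq0); rewrite E mulrCA -ee' ez0 subr0.
by rewrite comp_mpoly_id.
Qed.

(** The substitution b parametrises the cone: its value at v is the point
    v_0 v - (bil v v / 2) e_max, and F \o b = 0 by hypothesis.  Modulo q it is
    the substitution of X_0 X_i for X_i, which multiplies F by X_0^k; so q
    divides X_0^k F, and X_0 can be cancelled. *)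
Lemma cone_vanish k F : F \is k.-homog ->
  (forall w, w ord0 0 != 0 -> bil w w = 0 -> F.@[fun i => w i 0] = 0) ->
  exists g, F = quad * g.
Proof.
move=> hF F0.
pose a : n.-tuple A := [tuple X0 * 'X_i | i < n].
pose b : n.-tuple A :=
  [tuple X0 * 'X_i - quad * (if i == ord_max then (2^-1)%:MP else 0) | i < n].
have Fb : F \mPo b = 0.
  apply: (mulfI X0_neq0); rewrite mulr0; apply: mpoly_eq0_of_meval => v.
  rewrite mevalM mevalXU comp_mpoly_meval.
  have [->|v0] := eqVneq (v ord0) 0; first by rewrite mul0r.
  pose u : 'cV[K]_n := \col_i v i.
  pose w := v ord0 *: u - (bil u u / 2) *: evec ord_max.
  have uE : quad.@[v] = bil u u.
    by rewrite -meval_quad; apply: meval_eq => i; rewrite mxE.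
  have umax : bil u (evec ord_max) = v ord0 by rewrite bil_delta revmax mxE.
  rewrite (meval_eq (v2 := fun i => w i 0)) ?F0 ?mulr0 //.
  - by rewrite !mxE ord0_neq_max mulr0 subr0 mulf_neq0.
  - rewrite /w !(bilBl, bilBr, bilZl, bilZr) umax (bilC _ u) umax.
    by rewrite bil_delta revmax mxE ord0_neq_max /=; field.
  - move=> i; rewrite tnth_mktuple mevalB !mevalM !mevalXU uE !mxE eqxx andbT.
    by case: eqP => _; rewrite ?mevalC ?meval0 ?mulr0 ?mulr1.
have [i|e] := @comp_mpoly_congr K n n a b quad _ F.
  rewrite !tnth_mktuple opprB addrC subrK; eexists; reflexivity.
rewrite Fb subr0 (comp_mpoly_scaled _ hF); elim: k {hF} e => [|k IHk] e.
  by rewrite expr0 mul1r; exists e.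
rewrite exprS -mulrA => /X0_cancel[g]; exact: IHk.
Qed.

Lemma harmonic_cone_vanish k F : harmonic k F ->
  (forall w, w ord0 0 != 0 -> bil w w = 0 -> F.@[fun i => w i 0] = 0) -> F = 0.
Proof.
move=> hF F0; have /andP[Fk _] := hF.
by have [g] := cone_vanish Fk F0; apply: harmonic_quad_multiple hF.
Qed.

End Cone.

(** * The generating polynomial of a linear functional *)

Section Generating.
Variables (K : numFieldType) (m : nat).
Local Notation n := m.+1.
Local Notation A := {mpoly K[n]}.
Implicit Types (f : A -> K) (p g : A).

Definition mfact (l : 'X_{1..n}) : K := (\prod_i (l i)`!)%:R.

(** The component of degree k of the formal expression f (exp (\sum_j x_j y_j)),
    with f applied in the variables x and the outcome a polynomial in y. *)
Definition genfun f k : A :=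
  \sum_(l : 'X_{1..n < k.+1})
     (if mdeg l == k then f 'X_[l] / mfact l else 0) *: 'X_[l].

Lemma mfact_neq0 l : mfact l != 0.
Proof. by rewrite pnatr_eq0 -lt0n prodn_gt0 // => i; apply: fact_gt0. Qed.

Lemma mfactD1 l j : mfact (l + U_(j)) = (l j).+1%:R * mfact l.
Proof.
rewrite /mfact -natrM (bigD1 j) //= [in RHS](bigD1 j) //= mulnA; congr (_ * _)%:R.
  by rewrite mnmDE mnm1E eqxx addn1 factS.
by apply: eq_bigr => i ij; rewrite mnmDE mnm1E eq_sym (negbTE ij) addn0.
Qed.

Lemma genfunE f k l :
  (genfun f k)@_l = if mdeg l == k then f 'X_[l] / mfact l else 0.
Proof.
case: (ltnP (mdeg l) k.+1) => lk;
  first exact: (mcoeff_mpoly (fun l =>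
    if mdeg l == k then f 'X_[l] / mfact l else 0)).
rewrite gtn_eqF // raddf_sum big1 //= => l' _; rewrite mcoeffZ mcoeffX.
have [E|_] := eqVneq (val l') l; last by rewrite mulr0.
by move: lk; rewrite -E leqNgt bmdeg.
Qed.

Lemma genfun_homog f k : genfun f k \is k.-homog.
Proof.
apply/dhomogP=> l; rewrite mcoeff_msupp genfunE.
by case: (mdeg l =P k) => // _; rewrite eqxx.
Qed.

Lemma genfun_deriv f k j :
  (genfun f k.+1)^`M(j) = genfun (fun p => f ('X_j * p)) k.
Proof.
apply/mpolyP=> l; rewrite mcoeff_deriv !genfunE mdegD mdeg1 addn1 eqSS.
case: eqP => _; last by rewrite mul0rn.
rewrite mpolyXD [_ * 'X_j]mulrC mfactD1 -mulr_natl; field.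
by rewrite mfact_neq0 nat1r pnatr_eq0.
Qed.

Lemma genfun_sum (I : finType) (c : I -> K) (F : I -> A -> K) k :
  genfun (fun p => \sum_i c i * F i p) k = \sum_i c i *: genfun (F i) k.
Proof.
apply/mpolyP=> l; rewrite genfunE raddf_sum /=.
under [RHS]eq_bigr => i _ do rewrite mcoeffZ genfunE.
case: eqP => _; last by rewrite big1 // => i _; rewrite mulr0.
by rewrite mulr_suml; apply: eq_bigr => i _; rewrite mulrA.
Qed.

Lemma eq_genfun f1 f2 k : f1 =1 f2 -> genfun f1 k = genfun f2 k.
Proof. by move=> f12; apply/mpolyP=> l; rewrite !genfunE f12. Qed.

Lemma scalar_sum f (I : Type) (s : seq I) (c : I -> K) (p : I -> A) :
  scalar f -> f (\sum_(i <- s) c i *: p i) = \sum_(i <- s) c i * f (p i).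
Proof.
move=> hf; have f0 : f 0 = 0.
  by have := hf (-1) 0 0; rewrite scaler0 addr0 mulN1r addNr.
elim/big_rec2: _ => // i y1 y2 _ <-; by rewrite hf.
Qed.

Lemma genfun_laplacian f k : scalar f ->
  laplacian (genfun f k.+2) = genfun (fun p => f (quad K m * p)) k.
Proof.
move=> hf; rewrite /laplacian.
under eq_bigr => j _ do rewrite !genfun_deriv -[genfun _ _]scale1r.
rewrite -genfun_sum; apply: eq_genfun => p; rewrite -scalar_sum //.
congr f; rewrite /quad mulr_suml; apply: eq_bigr => j _.
by rewrite scale1r mulrA.
Qed.

Lemma meval_genfun f k (v : 'I_n -> K) : scalar f ->
  k`!%:R * (genfun f k).@[v] = f ((\sum_j v j *: 'X_j) ^+ k).
Proof.
elim: k f => [|k IHk] f hf.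
  rewrite mul1r expr0 (_ : genfun f 0 = (f 1)%:MP) ?mevalC //.
  apply/mpolyP=> l; rewrite genfunE mcoeffC mdeg_eq0.
  case: eqP => [->|_]; rewrite ?mulr1 ?mulr0 // mpolyX0.
  rewrite /mfact big1 ?divr1 // => i _; by rewrite mnm0E.
have hf' j : scalar (fun p => f ('X_j * p)).
  by move=> a p q; rewrite mulrDr -scalerAr hf.
have E : k.+1%:R * (genfun f k.+1).@[v]
    = \sum_j v j * (genfun (fun p => f ('X_j * p)) k).@[v].
  rewrite -mevalZ -(euler (genfun_homog f k.+1)) raddf_sum /=.
  by apply: eq_bigr => j _; rewrite mevalM mevalXU genfun_deriv.
rewrite factS mulnC natrM -mulrA E mulr_sumr exprS mulr_suml.
under [in RHS]eq_bigr => j _ do rewrite -scalerAl.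
rewrite scalar_sum //; apply: eq_bigr => j _.
by rewrite mulrCA IHk.
Qed.
End Generating.

(** * Irreducibility of the space of harmonic forms *)

Section HomogeneousPart.
Variables (K : numFieldType) (m : nat).
Local Notation n := m.+1.
Local Notation A := {mpoly K[n]}.
Implicit Types (p q : A).

(** Unlike indhomog this is linear, being a projection. *)
Definition homog_part k p : SymT K m k := DHomog (pihomogP mdeg k p).

Lemma homog_part_is_linear k : linear (homog_part k).
Proof. by move=> a p q; apply: val_inj; rewrite /= linearP. Qed.
HB.instance Definition _ k :=
  GRing.isLinear.Build K A (SymT K m k) _ (homog_part k) (homog_part_is_linear k).

Lemma homog_partE k p : p \is k.-homog -> homog_part k p = p :> A.
Proof. exact: pihomog_dE. Qed.

Lemma homog_partK k (x : SymT K m k) : homog_part k x = x.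
Proof. by apply: val_inj; exact: (homog_partE (dhomog_is_dhomog x)). Qed.

(** The functionals used are the coefficients of x - projv W x, extended to all
    polynomials through the homogeneous part of degree k. *)
Lemma mem_functional k (W : {vspace SymT K m k}) (x : SymT K m k) :
  (forall phi : A -> K, scalar phi ->
     (forall y : SymT K m k, y \in W -> phi y = 0) -> phi x = 0) -> x \in W.
Proof.
move=> phi0.
suff -> : x = projv W x by apply: memv_proj.
apply: val_inj; apply/mpolyP=> l; apply/eqP; rewrite -subr_eq0; apply/eqP.
rewrite -mcoeffB.
pose phi p := (mpoly_of_dhomog (homog_part k p)
  - mpoly_of_dhomog (projv W (homog_part k p)))@_l.
suff: phi x = 0 by rewrite /phi homog_partK.
apply: phi0 => [a p q|y yW]; last by rewrite /phi homog_partK projv_id // subrr mcoeff0.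
by rewrite /phi !linearP /= !mcoeffB !(mcoeffD, mcoeffZ); ring.
Qed.

Definition quadmul i k r (x : SymT K m k) : SymT K m r :=
  homog_part r (quad K m ^+ i * mpoly_of_dhomog x).

Lemma quadmul_is_linear i k r : linear (@quadmul i k r).
Proof. by move=> a x y; rewrite /quadmul linearP /= mulrDr -scalerAr linearP. Qed.
HB.instance Definition _ i k r :=
  GRing.isLinear.Build K _ _ _ (@quadmul i k r) (@quadmul_is_linear i k r).

Lemma quadmulE i k r (x : SymT K m k) : (2 * i + k = r)%N ->
  quadmul i r x = quad K m ^+ i * mpoly_of_dhomog x :> A.
Proof.
by move=> <-; apply: homog_partE; exact: (quadX_homog i (dhomog_is_dhomog x)).
Qed.

Definition laplacian_hom k (x : SymT K m k) : SymT K m (k - 2) :=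
  homog_part (k - 2) (laplacian (mpoly_of_dhomog x)).

Lemma laplacian_hom_is_linear k : linear (@laplacian_hom k).
Proof. by move=> a x y; rewrite /laplacian_hom !linearP. Qed.
HB.instance Definition _ k :=
  GRing.isLinear.Build K _ _ _ (@laplacian_hom k) (@laplacian_hom_is_linear k).

Definition harm_space k : {vspace SymT K m k} := lker (linfun (@laplacian_hom k)).

Lemma mem_harm k (x : SymT K m k) :
  (x \in harm_space k) = (laplacian (mpoly_of_dhomog x) == 0).
Proof.
rewrite memv_ker lfunE /= /laplacian_hom -(inj_eq val_inj) /=.
case: (ltnP k 2) => k2.
  by rewrite (laplacian_low k2 (dhomog_is_dhomog x)) raddf0 eqxx.
rewrite pihomog_dE //; apply: laplacian_homog.
by rewrite -addn2 subnK //; apply: dhomog_is_dhomog.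
Qed.

Lemma mem_harmE k (x : SymT K m k) :
  (x \in harm_space k) = harmonic k (mpoly_of_dhomog x).
Proof. by rewrite mem_harm /harmonic dhomog_is_dhomog. Qed.

End HomogeneousPart.

Section Reflections.
Variables (K : numFieldType) (n : nat).
Implicit Types a b u v w e : 'cV[K]_n.

(** When a is isotropic the inverse of bil a a is 0 and refl a is the identity. *)
Definition refl a : 'M[K]_n := 1%:M - (2 / bil a a) *: (a *m a^T *m gram K n).

Lemma reflE a w : refl a *m w = w - (2 * bil a w / bil a a) *: a.
Proof.
rewrite mulmxBl mul1mx -scalemxAl -!mulmxA [_^T *m _]mulmxA bilE.
by rewrite mul_mx_scalar scalerA mulrAC.
Qed.

Lemma bil_refl a u v : bil (refl a *m u) v = bil u (refl a *m v).
Proof.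
by rewrite !reflE bilBl bilBr bilZl bilZr (bilC a u); ring.
Qed.

Lemma refl_fix b e : bil b e = 0 -> refl b *m e = e.
Proof. by move=> be; rewrite reflE be mulr0 mul0r scale0r subr0. Qed.

(** The reflection in w - e swaps e and w because they have the same norm. *)
Lemma refl_swap e w : bil e e = 0 -> bil w w = 0 -> bil w e != 0 ->
  bil (w - e) (w - e) != 0 /\ refl (w - e) *m e = w.
Proof.
move=> ee ww we.
have E : bil (w - e) (w - e) = - (2 * bil w e).
  by rewrite bilBl !bilBr ee ww (bilC e); ring.
have E0 : bil (w - e) (w - e) != 0.
  by rewrite E oppr_eq0 mulf_neq0 // pnatr_eq0.
split=> //; rewrite reflE E bilBl ee subr0 invrN mulrN divff ?scaleN1r ?opprK.
  by rewrite addrC subrK.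
by rewrite mulf_neq0 // pnatr_eq0.
Qed.

End Reflections.

Section Irreducible.
Variables (K : numFieldType) (m : nat).
Hypothesis m2 : (2 <= m)%N.
Local Notation n := m.+1.
Local Notation A := {mpoly K[n]}.
Local Notation evec := (evec K).
Local Notation e0 := (@evec m ord0).
Local Notation emax := (@evec m ord_max).
Local Notation b0 := (midvec K m2).

Lemma meval_subst k (M : 'M[K]_n) (p : SymT K m k) (w : 'cV[K]_n) :
  (mpoly_of_dhomog (sym_subst M p)).@[fun i => w i 0]
    = (mpoly_of_dhomog p).@[fun i => (M *m w) i 0].
Proof.
rewrite sym_substE comp_mpoly_meval; apply: meval_eq => i.
rewrite tnth_mktuple raddf_sum mxE; apply: eq_bigr => j _ /=.
by rewrite mevalZ mevalXU.
Qed.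

Lemma bil_b0_e0 : bil b0 e0 = 0.
Proof. by rewrite bil_delta rev0 midvec_max. Qed.

Lemma bil_b0_emax : bil b0 emax = 0.
Proof. by rewrite bil_delta revmax midvec0. Qed.

Lemma bil_e0 : bil e0 e0 = 0.
Proof. by rewrite bil_delta rev0 mxE eq_sym ord0_neq_max. Qed.

Lemma bil_emax : bil emax emax = 0.
Proof. by rewrite bil_delta revmax mxE ord0_neq_max. Qed.

Lemma bil_e0max : bil e0 emax = 1.
Proof. by rewrite bil_delta revmax mxE !eqxx. Qed.

Variables (k : nat) (W : {vspace SymT K m k}).
Hypothesis Wstable : forall a b, bil a a != 0 -> bil b b != 0 ->
  forall p, p \in W -> sym_subst (refl a *m refl b) p \in W.
Hypothesis Wharm : forall p, p \in W -> laplacian (mpoly_of_dhomog p) = 0.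
Hypothesis Wn0 : W != 0%VS.

Definition top_mono : 'X_{1..n} := (U_(ord_max) *+ k)%MM.

Lemma top_monoP (l : 'X_{1..n}) : mdeg l = k -> (k <= l ord_max)%N -> l = top_mono.
Proof.
rewrite mdegE (bigD1 ord_max) //= => lk kl.
have lmax : l ord_max = k by apply/eqP; rewrite eqn_leq kl -{1}lk leq_addr.
have /eqP : (\sum_(i < n | i != ord_max) l i = 0)%N.
  by apply/eqP; rewrite -(eqn_add2l (l ord_max)) lk addn0 lmax.
rewrite sum_nat_eq0 => /forallP l0; apply/mnmP=> i; rewrite mulmnE mnm1E eq_sym.
have := l0 i; case: eqVneq => [-> _|_ /= /eqP ->]; first by rewrite mul1n.
by rewrite mul0n.
Qed.

Lemma meval_emax (p : SymT K m k) :
  (mpoly_of_dhomog p).@[fun i => emax i 0] = (mpoly_of_dhomog p)@_top_mono.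
Proof.
have E l : mdeg l = k -> \prod_i emax i 0 ^+ l i = (l == top_mono)%:R.
  move=> lk; have [->|lt] := eqVneq l top_mono.
    rewrite big1 // => i _; rewrite mxE andbT mulmnE mnm1E eq_sym.
    by case: eqVneq => _; rewrite ?expr1n.
  have [i imax li] : exists2 i, i != ord_max & l i != 0%N.
    apply/exists_inP; apply: contraNT lt; rewrite negb_exists_in => /forall_inP l0.
    apply/eqP/top_monoP => //; rewrite -lk mdegE (bigD1 ord_max) //= big1 ?addn0 //.
    by move=> i /l0; rewrite negbK => /eqP.
  by rewrite (bigD1 i) //= mxE (negbTE imax) expr0n (negbTE li) mul0r.
rewrite mevalE [RHS](_ : _ =
    \sum_(l <- msupp p) (mpoly_of_dhomog p)@_l * (l == top_mono)%:R).
  apply: eq_big_seq => l lp; rewrite E //.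
  exact: (dhomog_mf (dhomog_is_dhomog p) lp).
rewrite {1}[mpoly_of_dhomog p]mpolyE raddf_sum /=.
by apply: eq_bigr => l _; rewrite mcoeffZ mcoeffX.
Qed.

(** The one-parameter group scaling the hyperbolic pair, written as a product
    of two reflections in the hyperbolic plane. *)
Definition torus (c : K) : 'M[K]_n := refl (e0 + c *: emax) *m refl (e0 + emax).

Lemma torusE c i j : c != 0 -> torus c i j =
  (if i == ord0 then c^-1 else if i == ord_max then c else 1) * (i == j)%:R.
Proof.
move=> c0.
have -> : torus c i j = (torus c *m evec j) i 0.
  by rewrite -[evec j]/(delta_mx j 0) -colE [RHS]mxE.
rewrite /torus -mulmxA; set w := evec j.
have bb : bil (e0 + emax) (e0 + emax) = 2.
  by rewrite bilDl !bilDr (bilC emax) bil_e0 bil_emax bil_e0max; ring.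
have aa : bil (e0 + c *: emax) (e0 + c *: emax) = 2 * c.
  rewrite bilDl !bilDr !bilZl !bilZr (bilC emax) bil_e0 bil_emax bil_e0max; ring.
have w0 : bil e0 w = w ord_max 0 by rewrite bilC bil_delta rev0.
have wmax : bil emax w = w ord0 0 by rewrite bilC bil_delta revmax.
rewrite !reflE aa bb !(bilDl, bilBr, bilZl, bilZr, bilDr) (bilC emax e0).
rewrite bil_e0 bil_emax bil_e0max w0 wmax.
have -> : (i == j)%:R = w i 0 by rewrite mxE andbT.
rewrite !mxE !andbT; set x := (ord_max == j)%:R; set y := (ord0 == j)%:R.
have [->|i0] := eqVneq i ord0; last have [->|imax] := eqVneq i ord_max.
- by rewrite ord0_neq_max // -/y /=; field.
- by rewrite -/x /=; field.
by rewrite /=; field.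
Qed.

Definition top_form : SymT K m k := homog_part k 'X_[top_mono].

Lemma top_formE : top_form = 'X_[top_mono] :> A.
Proof. by apply: homog_partE; rewrite dhomogX /= mdegMn mdeg1 mul1n. Qed.

(** For a functional phi killing W, the values c^k phi(p \o torus c) are those
    of a polynomial P in c.  They vanish for c <> 0, and the coefficient of P
    of degree 2 k is the one contributed by X_max^k alone. *)
Lemma top_form_mem_of_coeff (p : SymT K m k) : p \in W ->
  (mpoly_of_dhomog p)@_top_mono != 0 -> top_form \in W.
Proof.
move=> pW ptop; apply: mem_functional => phi hphi phiW.
rewrite top_formE.
(* The weight l_max - l_0 of the torus, shifted by k to be a natural number. *)
pose wt (l : 'X_{1..n}) := (k + l ord_max - l ord0)%N.
pose P : {poly K} :=
  \sum_(l <- msupp p) ((mpoly_of_dhomog p)@_l * phi 'X_[l]) *: 'X^(wt l).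
have dk l : l \in msupp p -> mdeg l = k.
  by move=> lp; exact: (dhomog_mf (dhomog_is_dhomog p) lp).
have P0 : P = 0.
  apply: poly_eq0_of_horner => c c0.
  have aa : bil (e0 + c *: emax) (e0 + c *: emax) != 0.
    rewrite bilDl !bilDr !bilZl !bilZr (bilC emax) bil_e0 bil_emax bil_e0max.
    by rewrite !(mulr1, mulr0, addr0, add0r) -mulr2n mulrn_eq0.
  have bb : bil (e0 + emax) (e0 + emax) != 0.
    rewrite bilDl !bilDr (bilC emax) bil_e0 bil_emax bil_e0max.
    by rewrite !(mulr1, mulr0, addr0, add0r) -mulr2n mulrn_eq0 oner_eq0.
  have := phiW _ (Wstable aa bb pW); rewrite -/(torus c) sym_substE comp_mpolyEX.
  have E l : l \in msupp p -> 'X_[l] \mPo [tuple lin_form (torus c) j | j < n]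
      = (c ^+ l ord_max * c ^- l ord0) *: 'X_[l].
    move=> lp; rewrite comp_mpolyX mpolyXE_id.
    pose d (i : 'I_n) := if i == ord0 then c^-1 else if i == ord_max then c else 1.
    have -> : c ^+ l ord_max * c ^- l ord0 = \prod_i d i ^+ l i.
      rewrite (bigD1 ord0) //= (bigD1 ord_max) ?[_ == ord0]eq_sym ?ord0_neq_max //=.
      rewrite /d eqxx [_ == ord0]eq_sym ord0_neq_max // eqxx big1 ?mulr1.
        by rewrite mulrC exprVn.
      by move=> i /andP[/negbTE -> /negbTE ->]; rewrite expr1n.
    rewrite -scaler_prod; apply: eq_bigr => i _; rewrite tnth_mktuple -exprZn.
    congr (_ ^+ _); rewrite /lin_form (bigD1 i) //= big1 ?addr0 => [|j ji].
      by rewrite torusE // eqxx mulr1.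
    by rewrite torusE // [i == j]eq_sym (negbTE ji) mulr0 scale0r.
  rewrite (eq_big_seq (fun l => ((mpoly_of_dhomog p)@_l
      * (c ^+ l ord_max * c ^- l ord0)) *: 'X_[l])); last first.
    by move=> l lp; rewrite /= E // scalerA.
  rewrite scalar_sum // => /(congr1 ( *%R (c ^+ k))); rewrite mulr0 => <-.
  rewrite horner_sum mulr_sumr; apply: eq_big_seq => l lp.
  have l0k : (l ord0 <= k)%N by rewrite -(dk l lp) mdegE (bigD1 ord0) //= leq_addr.
  rewrite hornerZ hornerXn /wt -addnBAC // exprD exprB ?unitfE //.
  by ring.
have := congr1 (fun P : {poly K} => P`_(k + k)) P0; rewrite coef0 coef_sum.
rewrite (bigD1_seq top_mono) ?msupp_uniq ?mcoeff_msupp //= coefZ coefXn.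
rewrite {1}/wt /top_mono !mulmnE !mnm1E eqxx [_ == ord0]eq_sym ord0_neq_max //=.
rewrite mul0n subn0 mul1n eqxx mulr1 big1_seq ?addr0; last first.
  move=> l /andP[lt lp]; rewrite coefZ coefXn (_ : (_ == _) = false) ?mulr0 //.
  apply: contra_neqF lt => /eqP E; apply: top_monoP; first exact: dk.
  by rewrite -(leq_add2l k) E leq_subr.
by move=> /eqP; rewrite mulf_eq0 (negbTE ptop) => /eqP.
Qed.

(** Otherwise top_form_mem_of_coeff prevents the elements of W from taking
    nonzero values at e_max, hence, moving points by reflections, at any point
    of the cone with w_0 <> 0. *)
Lemma top_form_mem : top_form \in W.
Proof.
apply: contraT => topW.
pose p := vpick W.
have pW : p \in W by apply: memv_pick.
have hp : harmonic k (mpoly_of_dhomog p).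
  by rewrite /harmonic dhomog_is_dhomog Wharm ?eqxx.
have : mpoly_of_dhomog p = 0.
  apply: (harmonic_cone_vanish m2 hp) => w w0 ww; apply/eqP.
  apply: contraNT topW => wp.
  have we : bil w emax != 0 by rewrite bil_delta revmax.
  have [a0 aE] := refl_swap bil_emax ww we.
  apply: (top_form_mem_of_coeff (Wstable a0 (bil_midvec K m2) pW)).
  by rewrite -meval_emax meval_subst -mulmxA (refl_fix bil_b0_emax) aE.
by move/eqP; rewrite (inj_eq val_inj _ 0) vpick0 (negbTE Wn0).
Qed.

(** Composing X_max = bil e_0 with the orthogonal map M = refl b refl a gives
    the linear form bil (refl a (refl b e_0)), and a is chosen so that this
    vector is w with its coordinates reversed. *)
Lemma isotropic_power_mem (w : 'cV[K]_n) : w ord0 0 != 0 -> bil w w = 0 ->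
  exists2 x : SymT K m k, x \in W & x = (\sum_j w j 0 *: 'X_j) ^+ k :> A.
Proof.
move=> w0 ww; pose w' : 'cV[K]_n := \col_i w (rev_ord i) 0.
have ww' : bil w' w' = 0.
  rewrite -ww /bil [RHS](reindex_inj rev_ord_inj) /=.
  by apply: eq_bigr => i _; rewrite !mxE.
have we : bil w' e0 != 0 by rewrite bil_delta rev0 mxE revmax.
have [a0 aE] := refl_swap bil_e0 ww' we.
exists (sym_subst (refl b0 *m refl (w' - e0)) top_form).
  by apply: Wstable top_form_mem => //; apply: bil_midvec.
rewrite sym_substE top_formE -mpolyXn rmorphXn /= comp_mpolyXU.
rewrite -tnth_nth tnth_mktuple; congr (_ ^+ _); apply: eq_bigr => j _.
congr (_ *: _).
set M := _ *m _.
have -> : M ord_max j = bil (M *m evec j) e0.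
  by rewrite bil_delta rev0 -colE [RHS]mxE.
rewrite /M -mulmxA !bil_refl (refl_fix bil_b0_e0) aE bilC bil_delta mxE.
by rewrite rev_ordK.
Qed.

(** A functional phi killing both W and the multiples of q has a generating
    polynomial that is harmonic and vanishes on the cone, so phi = 0 and h is
    congruent modulo q to an element of W; their difference is a harmonic
    multiple of q. *)
Lemma harmonic_mem (h : SymT K m k) : harmonic k (mpoly_of_dhomog h) -> h \in W.
Proof.
move=> hh.
pose Q : {vspace SymT K m k} := limg (linfun (@quadmul K m 1 (k - 2) k)).
have : h \in (W + Q)%VS.
  apply: mem_functional => phi hphi phi0.
  have g0 : genfun phi k = 0.
    apply: (@harmonic_cone_vanish _ _ m2 k) => [|w w0 ww].
      rewrite /harmonic genfun_homog /=; case: (ltnP k 2) => k2.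
        by rewrite (laplacian_low k2 (genfun_homog _ _)).
      rewrite -(subnK k2) addn2 genfun_laplacian //.
      apply/eqP/mpolyP=> l; rewrite genfunE mcoeff0; case: eqP => // lk.
      pose x : SymT K m (k - 2) := homog_part (k - 2) 'X_[l].
      have := phi0 (quadmul 1 k x); rewrite quadmulE ?subnKC // expr1 homog_partE.
        move=> ->; first by rewrite mul0r.
        apply: (subvP (addvSr _ _)).
        by rewrite -[quadmul _ _ _](lfunE (@quadmul K m 1 (k - 2) k)) memv_img ?memvf.
      by rewrite dhomogX; apply/eqP.
    have [x xW xE] := isotropic_power_mem w0 ww.
    have kf : k`!%:R != 0 :> K by rewrite pnatr_eq0 -lt0n fact_gt0.
    apply: (mulfI kf); rewrite mulr0 meval_genfun // -xE.
    by apply: phi0; apply: (subvP (addvSl _ _)).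
  have phiX l : mdeg l = k -> phi 'X_[l] = 0.
    move=> lk; have := congr1 (mcoeff l) g0; rewrite genfunE lk eqxx mcoeff0.
    by move/eqP; rewrite mulf_eq0 invr_eq0 (negbTE (mfact_neq0 _ _)) orbF => /eqP.
  rewrite [mpoly_of_dhomog h]mpolyE scalar_sum // big1_seq // => l /andP[_ lh].
  by rewrite phiX ?mulr0 //; exact: (dhomog_mf (dhomog_is_dhomog h) lh).
case/memv_addP=> w wW [y /memv_imgP[g _ yE] hE].
have [e qe] : exists e, mpoly_of_dhomog y = quad K m * e.
  have -> : y = quadmul 1 k g by rewrite yE lfunE.
  (* For k < 2 the truncated k - 2 is 0, and quadmul takes the component of
     degree k of a form of degree 2. *)
  case: (ltnP k 2) => k2; last first.
    by exists (mpoly_of_dhomog g); rewrite quadmulE ?subnKC // expr1.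
  exists 0; rewrite mulr0 /quadmul /= (@pihomog_ne0 _ _ _ (2 * 1 + (k - 2))%N) //.
    by rewrite gtn_eqF // (leq_trans k2).
  exact: (quadX_homog 1 (dhomog_is_dhomog g)).
suff y0 : y = 0 by rewrite hE y0 addr0.
apply: val_inj; apply: (harmonic_quad_multiple (k := k) _ qe).
rewrite /harmonic dhomog_is_dhomog.
have -> : y = h - w by rewrite hE addrC addKr.
have /andP[_ /eqP lh] := hh.
by rewrite linearB /= lh Wharm // subrr eqxx.
Qed.
End Irreducible.

(** * The action of P_1 on the tangent space *)

Section MidBlock.
Variables (K : fieldType) (m : nat).
Local Notation n := m.+1.
Local Notation N := m.+3.
Implicit Types (X V : 'M[K]_N) (x y : 'cV[K]_n).

Lemma val_mid (k : 'I_n) : mid k = k.+1 :> nat.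
Proof. by rewrite /= /bump [(m.+1 <= k)%N]leqNgt ltn_ord. Qed.

Lemma sum_mid (T : nmodType) (F : 'I_N -> T) :
  \sum_i F i = F ord0 + \sum_k F (mid k) + F ord_max.
Proof.
rewrite big_ord_recl big_ord_recr /= addrA; congr (_ + _ + _).
  by apply: eq_bigr => k _; congr F; apply: val_inj; exact: (esym (val_mid k)).
by congr F; apply: val_inj.
Qed.

Lemma rev_mid (k : 'I_n) : rev_ord (mid k) = mid (rev_ord k).
Proof.
apply: ord_inj; rewrite val_mid -[LHS]/(N - (mid k).+1)%N val_mid /= !subSS.
by rewrite -subSn // -ltnS.
Qed.

Lemma tangent_lift_row0 (u : 'rV[K]_n) l :
  tangent_lift u ord0 l = \sum_k u 0 k * (l == mid k)%:R.
Proof.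
rewrite summxE; apply: eq_bigr => k _; rewrite !mxE eqxx /=.
by rewrite rev_mid subr0.
Qed.

Lemma tangent_lift_col (u : 'rV[K]_n) l j :
  tangent_lift u l (mid j) = (l == ord0)%:R * u 0 j.
Proof.
rewrite summxE (bigD1 j) //= big1 ?addr0 => [|k kj]; rewrite !mxE mid_neqmax.
  by rewrite eqxx !andbT andbF subr0 mulrC.
by rewrite (inj_eq (@mid_inj m)) [j == k]eq_sym (negbTE kj) !andbF subr0 mulr0.
Qed.

Lemma sum_tangent_lift (u : 'rV[K]_n) (F : 'I_N -> K) :
  \sum_l tangent_lift u ord0 l * F l = \sum_k u 0 k * F (mid k).
Proof.
under eq_bigr => l _ do rewrite tangent_lift_row0 mulr_suml.
rewrite exchange_big /=; apply: eq_bigr => k _.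
rewrite (bigD1 (mid k)) //= eqxx mulr1 big1 ?addr0 // => l /negbTE ->.
by rewrite mulr0 mul0r.
Qed.

Lemma tangent_adE X k j :
  tangent_ad X k j = X ord0 ord0 * (k == j)%:R - X (mid k) (mid j).
Proof.
rewrite mxE /tangent_proj !mxE sum_tangent_lift; congr (_ - _).
  rewrite (bigD1 ord0) //= big1 ?addr0 => [|l /negbTE l0].
    by rewrite tangent_lift_col eqxx mul1r !mxE eqxx eq_sym.
  by rewrite tangent_lift_col l0 mul0r mulr0.
rewrite (bigD1 k) //= big1 ?addr0 => [|l lk]; first by rewrite mxE !eqxx mul1r.
by rewrite mxE eqxx /= (negbTE lk) mul0r.
Qed.

Definition mid_emb x : 'cV[K]_N := \sum_k x k 0 *: delta_mx (mid k) 0.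

Lemma mid_embE x k : mid_emb x (mid k) 0 = x k 0.
Proof.
rewrite summxE (bigD1 k) //= big1 ?addr0 => [|l lk]; rewrite !mxE.
  by rewrite !eqxx mulr1.
by rewrite (inj_eq (@mid_inj m)) eq_sym (negbTE lk) mulr0.
Qed.

Lemma mid_emb0 x : mid_emb x ord0 0 = 0.
Proof. by rewrite summxE big1 // => k _; rewrite !mxE eq_sym mid_neq0 mulr0. Qed.

Lemma mid_emb_max x : mid_emb x ord_max 0 = 0.
Proof. by rewrite summxE big1 // => k _; rewrite !mxE eq_sym mid_neqmax mulr0. Qed.

Lemma bil_mid (u v : 'cV[K]_N) : u ord0 0 = 0 -> v ord0 0 = 0 ->
  bil u v = \sum_k u (mid k) 0 * v (mid (rev_ord k)) 0.
Proof.
move=> u0 v0; rewrite /bil sum_mid u0 mul0r add0r rev_max v0 mulr0 addr0.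
by apply: eq_bigr => k _; rewrite rev_mid.
Qed.

Lemma bil_mid_emb x y : bil (mid_emb x) (mid_emb y) = bil x y.
Proof.
by rewrite bil_mid ?mid_emb0 //; apply: eq_bigr => k _; rewrite !mid_embE.
Qed.

Lemma mid_emb_is_linear : linear mid_emb.
Proof.
move=> a x y; rewrite /mid_emb scaler_sumr -big_split; apply: eq_bigr => k _ /=.
by rewrite !mxE scalerDl scalerA.
Qed.
HB.instance Definition _ :=
  GRing.isLinear.Build K 'cV[K]_n 'cV[K]_N _ mid_emb mid_emb_is_linear.

End MidBlock.

Section Levi.
Variables (K : numFieldType) (m : nat).
Local Notation n := m.+1.
Local Notation N := m.+3.
Implicit Types (s : 'M[K]_#|{set 'I_N}|).

Lemma two_neq0 : 2%:R != 0 :> K. Proof. by rewrite pnatr_eq0. Qed.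

(** An isometry fixing the line of e_max also preserves its orthogonal, the
    hyperplane where the coordinate 0 vanishes. *)
Lemma P1_rows s (V := vect s) (W := invmx V) : in_P1 s ->
  exists2 a, a != 0 &
    [/\ V ord_max ord_max = a,
        forall j, V ord0 j = a^-1 * (j == ord0)%:R &
        forall j, W ord0 j = a * (j == ord0)%:R].
Proof.
case=> sS sfix; have VU := vect_unit two_neq0 sS; rewrite -/V in VU sfix.
pose e : 'cV[K]_N := delta_mx ord_max 0; pose a := V ord_max ord_max.
have Ve : V *m e = a *: e.
  rewrite -colE; apply/colP=> i; rewrite [LHS]mxE [RHS]mxE [e _ _]mxE andbT.
  have [->|im] := eqVneq i ord_max; first by rewrite mulr1.
  by rewrite mulr0; have /forallP/(_ i)/implyP/(_ im)/eqP := sfix.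
have a0 : a != 0.
  apply: contraTneq isT => a0; have := mulKmx VU e; rewrite Ve a0 scale0r mulmx0.
  by move=> /colP/(_ ord_max)/eqP; rewrite !mxE !eqxx eq_sym oner_eq0.
have V0 j : V ord0 j = a^-1 * (j == ord0)%:R.
  apply: (mulfI a0); rewrite mulVKf //.
  have := bil_vect (delta_mx j 0) e two_neq0 sS; rewrite -/V Ve bilZr !bil_delta.
  by rewrite rev_max -colE [col _ _ _ _]mxE => ->; rewrite mxE andbT eq_sym.
exists a => //; split=> // j.
have VW : V *m W = 1%:M by apply: mulmxV.
have : (V *m W) ord0 j = (ord0 == j)%:R by rewrite VW mxE.
rewrite mxE (bigD1 ord0) //= big1 ?addr0 => [|k /negbTE k0]; last first.
  by rewrite V0 k0 mulr0 mul0r.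
by rewrite V0 eqxx mulr1 eq_sym => <-; rewrite mulVKf.
Qed.

(** For L the line of e_max, g / p_1 is Hom (L^perp / L, V / L^perp); the scalar
    factor is the action of s on V / L^perp and the middle block of the inverse
    of vect s is its inverse action on L^perp / L. *)
Lemma tangent_AdE_mid s : in_P1 s ->
  forall k j, tangent_Ad s k j =
    (vect s ord_max ord_max)^-1 * invmx (vect s) (mid k) (mid j).
Proof.
move=> sP k j; have [a a0 [-> V0 _]] := P1_rows sP.
rewrite [LHS]mxE [tangent_proj _ _ _]mxE -mulmxA mxE.
rewrite (bigD1 ord0) //= big1 ?addr0 => [|l /negbTE l0]; last first.
  by rewrite V0 l0 mulr0 mul0r.
rewrite V0 eqxx mulr1 mxE sum_tangent_lift; congr (_ * _).
rewrite (bigD1 k) //= big1 ?addr0 => [|l lk]; first by rewrite mxE !eqxx mul1r.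
by rewrite mxE eqxx /= (negbTE lk) mul0r.
Qed.

Lemma tangent_Ad_mulE s x : in_P1 s ->
  forall k, (tangent_Ad s *m x) k 0 =
    (vect s ord_max ord_max)^-1 * (invmx (vect s) *m mid_emb x) (mid k) 0.
Proof.
move=> sP k; rewrite [LHS]mxE [(_ *m mid_emb x) _ _]mxE sum_mid.
rewrite mid_emb0 mid_emb_max !mulr0 add0r addr0.
rewrite mulr_sumr; apply: eq_bigr => j _.
by rewrite tangent_AdE_mid // mid_embE mulrA.
Qed.

Lemma tangent_Ad_conformal s : in_P1 s -> exists2 c, c != 0 &
  forall x y, bil (tangent_Ad s *m x) (tangent_Ad s *m y) = c * bil x y.
Proof.
move=> sP; have [a a0 [aE _ W0]] := P1_rows sP.
exists (a^-1 ^+ 2) => [|x y]; first by rewrite expf_neq0 // invr_eq0.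
have [sS _] := sP; have VU := vect_unit two_neq0 sS.
have Wx0 z : (invmx (vect s) *m mid_emb z) ord0 0 = 0.
  rewrite mxE (bigD1 ord0) //= mid_emb0 mulr0 add0r big1 // => j /negbTE j0.
  by rewrite W0 j0 mulr0 mul0r.
have : bil (invmx (vect s) *m mid_emb x) (invmx (vect s) *m mid_emb y) = bil x y.
  by rewrite -(bil_vect _ _ two_neq0 sS) !mulKVmx // bil_mid_emb.
rewrite bil_mid // => <-; rewrite /bil mulr_sumr; apply: eq_bigr => k _.
by rewrite !tangent_Ad_mulE // aE; ring.
Qed.

Lemma cliff_inj (u v : 'cV[K]_N) : cliff u = cliff v -> u = v.
Proof. by move=> uv; apply/colP=> i; rewrite -!cliff_set0 uv. Qed.

(** Conjugation by a unit vector in the Clifford algebra is the opposite of a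
    reflection; for a product of two vectors the signs cancel. *)
Lemma cliff_refl (u w : 'cV[K]_N) : bil u u = 1 ->
  cliff u *m cliff w = cliff (- (refl u *m w)) *m cliff u.
Proof.
move=> u1; rewrite reflE u1 divr1 opprB linearB linearZ /= mulmxBl -scalemxAl.
rewrite cliff_sqr ?two_neq0 // u1 scale_scalar_mx mulr1 mulr_natl.
by rewrite -cliff_anticomm addrK.
Qed.

Lemma vect_pair (u v : 'cV[K]_N) : bil u u = 1 -> bil v v = 1 ->
  is_spin (cliff u *m cliff v) /\
  vect (cliff u *m cliff v) = refl u *m refl v.
Proof.
move=> u1 v1; have sS : is_spin (cliff u *m cliff v).
  exists [:: u; v]; split=> //=; first by rewrite u1 v1 eqxx.
  by rewrite !big_cons big_nil mulmx1.
split=> //; have sU := spin_unit two_neq0 sS.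
suff E (w : 'cV[K]_N) : vect (cliff u *m cliff v) *m w = refl u *m refl v *m w.
  apply/matrixP=> i j; have /colP/(_ i) := E (delta_mx j 0).
  by rewrite -!colE ![col _ _ _ _]mxE.
apply: cliff_inj; rewrite -vectP ?two_neq0 //.
rewrite -[_ *m _ *m cliff w]mulmxA cliff_refl // mulmxA cliff_refl //.
by rewrite -[_ *m _ *m cliff v]mulmxA mulmxK // mulmxN opprK mulmxA.
Qed.

Lemma refl_invol n' (a : 'cV[K]_n') : bil a a != 0 -> refl a *m refl a = 1%:M.
Proof.
move=> a0; apply/matrixP=> i j.
have -> : (refl a *m refl a) i j
    = (refl a *m (refl a *m (delta_mx j 0 : 'cV[K]_n'))) i 0.
  by rewrite mulmxA -colE [RHS]mxE.
have -> : (1%:M : 'M_n') i j = (delta_mx j 0 : 'cV[K]_n') i 0.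
  by rewrite !mxE andbT.
congr (fun_of_matrix _ i 0); set w := delta_mx j 0.
rewrite !reflE bilBr bilZr divfK // -addrA -opprD -scalerDl.
rewrite -[RHS]subr0; congr (_ - _).
by rewrite (_ : _ + _ = 0) ?scale0r //; field.
Qed.

Lemma reflZ n' (a : 'cV[K]_n') c : c != 0 -> refl (c *: a) = refl a.
Proof.
move=> c0; rewrite /refl bilZl bilZr [_^T]linearZ /=.
rewrite -!scalemxAl -scalemxAr -scalemxAl !scalerA.
congr (_ - _ *: _); have [->|a0] := eqVneq (bil a a) 0.
  by rewrite !mulr0 !invr0 !mulr0 !mul0r.
by field; rewrite a0.
Qed.

Lemma refl_mid_emb (a x : 'cV[K]_n) :
  refl (mid_emb a) *m mid_emb x = mid_emb (refl a *m x).
Proof. by rewrite !reflE !bil_mid_emb [RHS]linearB /= [mid_emb (_ *: _)]linearZ. Qed.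

End Levi.

(** Anisotropic vectors of the middle space are rescaled to norm 1, which takes
    square roots; they are orthogonal to e_max, so the product of their images
    in the Clifford algebra fixes it.  As tangent_Ad involves the inverse of
    vect, the two vectors are taken in the opposite order. *)
Lemma spin_refl (K : numClosedFieldType) m (a b : 'cV[K]_m.+1) :
  bil a a != 0 -> bil b b != 0 ->
  exists2 s, in_P1 s & tangent_Ad s = refl a *m refl b.
Proof.
move=> a0 b0.
pose unit_emb (c : 'cV[K]_m.+1) := (sqrtC (bil c c))^-1 *: mid_emb c.
have norm1 c : bil c c != 0 -> bil (unit_emb c) (unit_emb c) = 1.
  move=> c0; rewrite bilZl bilZr bil_mid_emb mulrA -invfM -expr2 sqrtCK.
  by rewrite mulVf.
have reflU c : bil c c != 0 -> refl (unit_emb c) = refl (mid_emb c).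
  by move=> c0; rewrite reflZ // invr_eq0 sqrtC_eq0.
have [sS sE] := vect_pair (norm1 b b0) (norm1 a a0).
rewrite !reflU // in sE.
set s := _ *m _ in sS sE.
pose e : 'cV[K]_m.+3 := delta_mx ord_max 0.
have se : vect s *m e = e.
  by rewrite sE -mulmxA !refl_fix // bil_delta rev_max mid_emb0.
have sP : in_P1 s.
  split=> //; apply/forallP=> i; apply/implyP=> im.
  by have /colP/(_ i) := se;
    rewrite -colE [col _ _ _ _]mxE [e _ _]mxE andbT (negbTE im) => ->.
exists s => //.
have s1 : vect s ord_max ord_max = 1.
  by have /colP/(_ ord_max) := se; rewrite -colE [col _ _ _ _]mxE [e _ _]mxE !eqxx.
have VU : vect s \in unitmx by apply: vect_unit; rewrite ?two_neq0.
apply/matrixP=> k j; pose x : 'cV[K]_m.+1 := delta_mx j 0.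
have E (M : 'M[K]_m.+1) : M k j = (M *m x) k 0 by rewrite -colE [RHS]mxE.
rewrite [LHS]E [RHS]E tangent_Ad_mulE // s1 invr1 mul1r -mulmxA.
have -> : mid_emb x = vect s *m mid_emb (refl a *m (refl b *m x)).
  rewrite sE -mulmxA !refl_mid_emb [refl a *m (refl a *m _)]mulmxA refl_invol //.
  by rewrite mul1mx [refl b *m (refl b *m _)]mulmxA refl_invol // mul1mx.
by rewrite mulKmx // mid_embE.
Qed.

Section Conformal.
Variables (K : numFieldType) (m : nat).
Local Notation n := m.+1.
Local Notation A := {mpoly K[n]}.
Implicit Types (p q : A) (M : 'M[K]_n).

Definition msubst M p : A := p \mPo [tuple lin_form M j | j < n].

Lemma mpoly_ring_ind (Q : A -> Prop) :
  (forall c, Q c%:MP) -> (forall i, Q 'X_i) -> (forall p q, Q p -> Q q -> Q (p + q)) ->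
  (forall p q, Q p -> Q q -> Q (p * q)) -> forall p, Q p.
Proof.
move=> QC QX QD QM; apply: mpoly_sum_ind => [l|c p q Qp Qq]; last first.
  by rewrite -mul_mpolyC; apply/QD/Qq/QM.
rewrite mpolyXE_id; elim/big_ind: _ => [||i _]; [exact: QC 1|exact: QM|].
by elim: (l i) => [|k IHk]; [exact: QC 1 | rewrite exprS; apply: QM].
Qed.

Lemma msubstX M j : msubst M 'X_j = lin_form M j.
Proof. by rewrite /msubst comp_mpolyXU -tnth_nth tnth_mktuple. Qed.

Lemma lin_form_deriv M j k : (lin_form M j)^`M(k) = (M j k)%:MP.
Proof.
rewrite /lin_form raddf_sum /= (bigD1 k) //= big1 ?addr0 => [|i ik].
  by rewrite mderivZ mderiv_var eqxx -alg_mpolyC.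
by rewrite mderivZ mderiv_var (negbTE ik) scaler0.
Qed.

Lemma mderiv_subst M k p :
  (msubst M p)^`M(k) = \sum_j (M j k)%:MP * msubst M p^`M(j).
Proof.
elim/mpoly_ring_ind: p => [c|i|p q IHp IHq|p q IHp IHq].
- rewrite /msubst comp_mpolyC mderivC big1 // => j _.
  by rewrite mderivC comp_mpoly0 mulr0.
- rewrite msubstX lin_form_deriv (bigD1 i) //= big1 ?addr0 => [|j ji].
    by rewrite mderiv_var eqxx /msubst rmorph1 mulr1.
  by rewrite mderiv_var eq_sym (negbTE ji) /msubst rmorph0 mulr0.
- rewrite /msubst rmorphD mderivD -/(msubst M p) -/(msubst M q) IHp IHq -big_split.
  by apply: eq_bigr => j _; rewrite /= -mulrDr mderivD /msubst rmorphD.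
rewrite /msubst rmorphM mderivM -/(msubst M p) -/(msubst M q) IHp IHq.
rewrite mulr_suml mulr_sumr -big_split; apply: eq_bigr => j _ /=.
by rewrite mderivM /msubst rmorphD !rmorphM /=; ring.
Qed.

Variables (M : 'M[K]_n) (c : K).
Hypothesis c0 : c != 0.
Hypothesis Mc : forall x y, bil (M *m x) (M *m y) = c * bil x y.

(** M and its transpose are similitudes with the same multiplier. *)
Lemma conformal_tr j l : \sum_k M j k * M l (rev_ord k) = c * (l == rev_ord j)%:R.
Proof.
pose G := gram K n.
have MGM : M^T *m G *m M = c *: G.
  apply/matrixP=> i k; pose x : 'cV[K]_n := delta_mx i 0.
  pose y : 'cV[K]_n := delta_mx k 0.
  have E (B : 'M[K]_n) : B i k = (x^T *m B *m y) 0 0.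
    by rewrite /x trmx_delta -rowE -colE !mxE.
  rewrite [LHS]E [RHS]E -scalemxAr -scalemxAl !mulmxA -trmx_mul -mulmxA.
  by rewrite !bilE Mc scale_scalar_mx.
have MGMt : M *m (c^-1 *: (G *m M^T *m G)) = 1%:M.
  apply: mulmx1C; rewrite -scalemxAl -!mulmxA [M^T *m _]mulmxA MGM.
  by rewrite -scalemxAr gramK scalerA mulVf // scale1r.
have {}MGMt : M *m G *m M^T = c *: G.
  have := congr1 (fun B => c *: (B *m G)) MGMt.
  rewrite mul1mx -scalemxAr -scalemxAl scalerA divff // scale1r => <-.
  by rewrite -!mulmxA gramK mulmx1.
have := congr1 (fun B : 'M_n => B j l) MGMt; rewrite [RHS]mxE [G _ _]mxE => <-.
rewrite mxE (reindex_inj rev_ord_inj); apply: eq_bigr => k _.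
rewrite mxE (bigD1 (rev_ord k)) //= big1 ?addr0 => [|i ik].
  by rewrite !mxE rev_ordK eqxx mulr1.
rewrite !mxE (_ : k == rev_ord i = false) ?mulr0 //.
by apply: contra_neqF ik => /eqP ->; rewrite rev_ordK.
Qed.

Lemma laplacian_subst p : laplacian (msubst M p) = c *: msubst M (laplacian p).
Proof.
have E k : (msubst M p)^`M(k)^`M(rev_ord k)
   = \sum_j \sum_l (M j k * M l (rev_ord k))%:MP * msubst M p^`M(j)^`M(l).
  rewrite mderiv_subst raddf_sum; apply: eq_bigr => j _ /=.
  rewrite mderivM mderivC mul0r add0r mderiv_subst mulr_sumr.
  by apply: eq_bigr => l _; rewrite mulrA mpolyCM.
rewrite /laplacian (eq_bigr _ (fun k _ => E k)) exchange_big /=.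
have -> : msubst M (\sum_j p^`M(j)^`M(rev_ord j))
    = \sum_j msubst M p^`M(j)^`M(rev_ord j).
  by rewrite /msubst raddf_sum.
rewrite scaler_sumr; apply: eq_bigr => j _; rewrite exchange_big /=.
under eq_bigr => l _ do rewrite -mulr_suml -raddf_sum /= conformal_tr.
rewrite (bigD1 (rev_ord j)) //= eqxx mulr1 mul_mpolyC big1 ?addr0 // => l /negbTE ->.
by rewrite mulr0 mul0r.
Qed.

Lemma quad_subst : msubst M (quad K m) = c *: quad K m.
Proof.
apply/eqP; rewrite -subr_eq0; apply/eqP/mpoly_eq0_of_meval => v.
pose w : 'cV[K]_n := \col_i v i.
rewrite mevalB mevalZ /msubst comp_mpoly_meval.
have -> : (quad K m).@[v] = bil w w.
  by rewrite -meval_quad; apply: meval_eq => i; rewrite mxE.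
apply/eqP; rewrite subr_eq0 -Mc -meval_quad; apply/eqP/meval_eq => i.
rewrite tnth_mktuple raddf_sum mxE; apply: eq_bigr => j _ /=.
by rewrite mevalZ mevalXU !mxE.
Qed.

End Conformal.

(** * Highest weights *)

Section Derivation.
Variables (K : numFieldType) (m : nat).
Local Notation n := m.+1.
Local Notation N := m.+3.
Local Notation A := {mpoly K[n]}.
Implicit Types (p q : A) (M : 'M[K]_n) (X : 'M[K]_N).

(** The derivation underlying sym_der, on polynomials of any degree. *)
Definition ext_der M p : A := \sum_j lin_form M j * p^`M(j).

Lemma ext_der_eigenM M a b p q : ext_der M p = a *: p -> ext_der M q = b *: q ->
  ext_der M (p * q) = (a + b) *: (p * q).
Proof.
move=> Dp Dq; rewrite scalerDl scalerAl -Dp scalerAr -Dq mulr_suml mulr_sumr.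
rewrite -big_split; apply: eq_bigr => j _ /=; rewrite mderivM; ring.
Qed.

Lemma ext_der_eigenX M a p k : ext_der M p = a *: p ->
  ext_der M (p ^+ k) = (k%:R * a) *: p ^+ k.
Proof.
move=> Dp; elim: k => [|k IHk].
  rewrite mul0r scale0r expr0 /ext_der big1 // => j _.
  by rewrite -mpolyC1 mderivC mulr0.
by rewrite exprS (ext_der_eigenM Dp IHk) -nat1r mulrDl mul1r.
Qed.

Lemma ext_der_var M j : ext_der M 'X_j = lin_form M j.
Proof.
rewrite /ext_der (bigD1 j) //= mderiv_var eqxx mulr1 big1 ?addr0 // => i ij.
by rewrite mderiv_var eq_sym (negbTE ij) mulr0.
Qed.

(** The middle block of X is skew for the form, so only the scalar part
    X_00 of tangent_ad X contributes. *)
Lemma ext_der_quad X : in_so X ->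
  ext_der (tangent_ad X) (quad K m) = (2 * X ord0 ord0) *: quad K m.
Proof.
move=> soX; pose S : A := \sum_j \sum_k X (mid j) (mid k) *: ('X_k * 'X_(rev_ord j)).
have S0 : S = 0.
  have SN : S = - S.
    rewrite {1}/S exchange_big (reindex_inj rev_ord_inj) -sumrN.
    apply: eq_bigr => j _; rewrite (reindex_inj rev_ord_inj) -sumrN /=.
    apply: eq_bigr => k _; rewrite (in_soP _ soX) !rev_mid !rev_ordK scaleNr.
    by rewrite mulrC.
  have /eqP : 2%:R *: S = 0 by rewrite scaler_nat mulr2n {1}SN addNr.
  by rewrite scaler_eq0 pnatr_eq0 => /eqP.
have E j : lin_form (tangent_ad X) j * (quad K m)^`M(j)
    = 2 *: (X ord0 ord0 *: ('X_j * 'X_(rev_ord j))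
        - \sum_k X (mid j) (mid k) *: ('X_k * 'X_(rev_ord j))).
  rewrite mderiv_quad mulrnAr scaler_nat; congr (_ *+ 2).
  have -> : lin_form (tangent_ad X) j
      = X ord0 ord0 *: 'X_j - \sum_k X (mid j) (mid k) *: 'X_k.
    rewrite /lin_form; under eq_bigr => k _ do rewrite tangent_adE scalerBl.
    rewrite sumrB (bigD1 j) //= eqxx mulr1 big1 ?addr0 // => k kj.
    by rewrite eq_sym (negbTE kj) mulr0 scale0r.
  rewrite mulrBl -scalerAl mulr_suml; congr (_ - _).
  by apply: eq_bigr => k _; rewrite scalerAl.
rewrite /ext_der (eq_bigr _ (fun j _ => E j)) -scaler_sumr sumrB -/S S0 subr0.
by rewrite -scaler_sumr scalerA.
Qed.

Lemma ext_der_top X : (forall k, k != ord_max -> X (mid ord_max) (mid k) = 0) ->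
  ext_der (tangent_ad X) 'X_ord_max
    = (X ord0 ord0 - X (mid ord_max) (mid ord_max)) *: 'X_ord_max.
Proof.
move=> X0; rewrite ext_der_var /lin_form (bigD1 ord_max) //= big1 ?addr0 => [|k km].
  by rewrite tangent_adE eqxx mulr1.
by rewrite tangent_adE X0 // eq_sym (negbTE km) mulr0 subr0 scale0r.
Qed.

End Derivation.

Section Weights.
Variables (K : numFieldType) (m : nat).
Local Notation N := m.+3.

Lemma weight_evalD (mu nu : weight K m) H :
  weight_eval (mu + nu) H = weight_eval mu H + weight_eval nu H.
Proof. by rewrite -big_split; apply: eq_bigr => k _; rewrite mxE mulrDl. Qed.

Lemma weight_evalMn (mu : weight K m) H k :
  weight_eval (mu *+ k) H = weight_eval mu H *+ k.
Proof.
elim: k => [|k IHk]; last by rewrite !mulrS weight_evalD IHk.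
by rewrite !mulr0n; apply: big1 => k _; rewrite mxE mul0r.
Qed.

Lemma weight_eval_eps k (H : 'M[K]_N) : (0 < k <= N./2)%N ->
  weight_eval (eps K m k) H = H (inord k.-1) (inord k.-1).
Proof.
case/andP=> k0 kr; have kl : (k.-1 < N./2)%N by rewrite prednK.
rewrite /weight_eval (bigD1 (Ordinal kl)) //= big1 ?addr0 => [|l lk].
  by rewrite mxE prednK // eqxx mul1r.
rewrite mxE (_ : l.+1 == k = false) ?mul0r //.
by apply: contra_neqF lk => /eqP E; apply: val_inj; rewrite /= -E.
Qed.

Lemma sum_eps1 : \sum_(1 <= l < 2) eps K m l = eps K m 1.
Proof. by rewrite big_nat1. Qed.

Lemma sum_eps2 : \sum_(1 <= l < 3) eps K m l = eps K m 1 + eps K m 2.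
Proof. by rewrite big_nat_recr // sum_eps1. Qed.

Lemma scale_half_double (x : weight K m) : (2%:R^-1 *: x) *+ 2 = x.
Proof. by rewrite -scaler_nat scalerA mulfV ?pnatr_eq0 // scale1r. Qed.

Lemma fund_weight1 : (2 <= m)%N -> fund_weight K m 1 = eps K m 1.
Proof.
move=> m2; rewrite /fund_weight (_ : (1%N == N./2) = false) ?sum_eps1; last first.
  by case: m m2 => [|[|[|m']]].
rewrite (_ : _ && _ = false) //.
by case: m m2 => [|[|[|[|m']]]] //= _; rewrite andbF.
Qed.

Lemma fund_weight_last i : i = N./2 ->
  fund_weight K m i = 2%:R^-1 *: \sum_(1 <= l < i.+1) eps K m l.
Proof. by move=> ->; rewrite /fund_weight eqxx. Qed.

Lemma fund_weight_prelast i : ~~ odd N -> i.+1 = N./2 ->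
  fund_weight K m i = 2%:R^-1 *: (\sum_(1 <= l < i.+1) eps K m l - eps K m i.+1).
Proof.
move=> even /(congr1 predn) /= ->; rewrite /fund_weight even eqxx ltn_eqF //.
Qed.

Lemma fund_weight2_Q3 : m = 2%N -> fund_weight K m 2 *+ 2 = eps K m 1 + eps K m 2.
Proof.
move=> m2; have r2 : 2%N = N./2 by rewrite m2.
by rewrite (fund_weight_last r2) scale_half_double sum_eps2.
Qed.

Lemma fund_weight23_Q4 : m = 3%N ->
  fund_weight K m 2 + fund_weight K m 3 = eps K m 1 + eps K m 2.
Proof.
move=> m3; have r3 : 3%N = N./2 by rewrite m3.
have even : ~~ odd N by rewrite m3.
rewrite (fund_weight_prelast even r3) (fund_weight_last r3).
rewrite -scalerDr sum_eps2.
have -> : \sum_(1 <= l < 4) eps K m l = eps K m 1 + eps K m 2 + eps K m 3.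
  by rewrite big_nat_recr //= sum_eps2.
by rewrite addrACA addNr addr0 -mulr2n -scalerMnr scale_half_double.
Qed.

Lemma fund_weight2 : (4 <= m)%N -> fund_weight K m 2 = eps K m 1 + eps K m 2.
Proof.
move=> m4; rewrite /fund_weight (_ : (2%N == N./2) = false) ?sum_eps2; last first.
  by case: m m4 => [|[|[|[|m']]]].
rewrite (_ : _ && _ = false) //.
by case: m m4 => [|[|[|[|[|m']]]]] //= _; rewrite andbF.
Qed.

Lemma fund_weight_comb (k i : nat) : (2 <= m)%N ->
  let lambda := @fund_weight K m in
  (if (m.+1 == 3)%N then lambda 2%N *+ (k * 2) + lambda 1%N *+ (2 * i)
   else if (m.+1 == 4)%N then (lambda 2%N + lambda 3%N) *+ k + lambda 1%N *+ (2 * i)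
   else lambda 2%N *+ k + lambda 1%N *+ (2 * i))
  = (eps K m 1 + eps K m 2) *+ k + eps K m 1 *+ (2 * i).
Proof.
move=> m2 lambda; rewrite /lambda fund_weight1 // !eqSS.
case: eqVneq => [E|n2]; first by rewrite mulnC mulrnA fund_weight2_Q3.
case: eqVneq => [E|n3]; first by rewrite fund_weight23_Q4.
rewrite fund_weight2 //.
by case: m m2 n2 n3 => [|[|[|[|m']]]].
Qed.
End Weights.

(** * The decomposition *)

Section Components.
Variables (K : numClosedFieldType) (m : nat).
Hypothesis m2 : (2 <= m)%N.
Local Notation n := m.+1.
Local Notation N := m.+3.
Local Notation A := {mpoly K[n]}.
Variables (r i : nat).
Hypothesis ir : (2 * i <= r)%N.
Local Notation k := (r - 2 * i)%N.
Local Notation qmul := (linfun (@quadmul K m i k r)).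

Definition component : {vspace SymT K m r} := (qmul @: harm_space K m k)%VS.

Lemma qmulE (x : SymT K m k) : qmul x = quad K m ^+ i * mpoly_of_dhomog x :> A.
Proof. by rewrite lfunE quadmulE // subnKC. Qed.

Lemma componentP (w : SymT K m r) :
  reflect (exists2 h : A, harmonic k h & mpoly_of_dhomog w = quad K m ^+ i * h)
          (w \in component).
Proof.
apply: (iffP memv_imgP) => [[x xh ->]|[h hh wE]].
  by exists (mpoly_of_dhomog x); rewrite -?mem_harmE // qmulE.
have /andP[hk _] := hh; exists (homog_part k h); first by rewrite mem_harmE homog_partE.
by apply: val_inj; rewrite /= qmulE homog_partE.
Qed.

Lemma sym_subst_qmul (M : 'M[K]_n) c (x : SymT K m k) :
  (forall u v, bil (M *m u) (M *m v) = c * bil u v) ->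
  sym_subst M (qmul x) = c ^+ i *: qmul (sym_subst M x).
Proof.
move=> Mc; apply: val_inj; rewrite /= sym_substE !qmulE sym_substE.
rewrite rmorphM rmorphXn /= -/(msubst M (quad K m)) (quad_subst Mc) exprZn.
by rewrite scalerAl.
Qed.

Lemma component_stable : P1_stable component.
Proof.
move=> s sP _ /memv_imgP[x xh ->]; have [c c0 Mc] := tangent_Ad_conformal sP.
rewrite /P1_act (sym_subst_qmul _ Mc) rpredZ // memv_img //.
move: xh; rewrite !mem_harm sym_substE => /eqP x0.
by rewrite -/(msubst _ _) (laplacian_subst c0 Mc) x0 /msubst comp_mpoly0 scaler0.
Qed.

Lemma quad_neq0 : quad K m != 0.
Proof.
have := bil_midvec K m2; rewrite -meval_quad; apply: contra_neq => ->.
by rewrite meval0.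
Qed.

Lemma qmul_eq0 (x : SymT K m k) : qmul x = 0 -> x = 0.
Proof.
move/(congr1 (@mpoly_of_dhomog _ _ _)); rewrite qmulE /= => qx0.
have q0 : quad K m ^+ i != 0 by rewrite expf_neq0 // quad_neq0.
by apply: val_inj; apply: (mulfI q0); rewrite qx0 mulr0.
Qed.

(** The preimage W of U under multiplication by q^i consists of harmonic forms
    and is preserved by products of two reflections, so it contains all
    harmonic forms as soon as U is nonzero. *)
Lemma component_minimal (U : {vspace SymT K m r}) : P1_stable U ->
  (U <= component)%VS -> U = 0%VS \/ U = component.
Proof.
move=> Ustab Ucomp; case: (eqVneq U 0%VS) => [->|U0]; [by left|right].
apply/eqP; rewrite eqEsubv Ucomp /=.
pose W := (harm_space K m k :&: qmul @^-1: U)%VS.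
have Wstable a b : bil a a != 0 -> bil b b != 0 ->
    forall p, p \in W -> sym_subst (refl a *m refl b) p \in W.
  move=> a0 b0 p; rewrite !memv_cap -!memv_preim => /andP[ph pU].
  have Mc u v : bil (refl a *m refl b *m u) (refl a *m refl b *m v) = 1 * bil u v.
    rewrite mul1r -!mulmxA bil_refl [refl a *m (refl a *m _)]mulmxA refl_invol //.
    by rewrite mul1mx bil_refl mulmxA refl_invol // mul1mx.
  apply/andP; split.
    move: ph; rewrite !mem_harm sym_substE => /eqP p0.
    rewrite -/(msubst _ _) (laplacian_subst (oner_neq0 _) Mc) p0.
    by rewrite /msubst comp_mpoly0 scaler0.
  have [s sP sE] := spin_refl a0 b0; have := Ustab s sP _ pU.
  by rewrite /P1_act sE (sym_subst_qmul _ Mc) expr1n scale1r.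
have Wharm p : p \in W -> laplacian (mpoly_of_dhomog p) = 0.
  by rewrite memv_cap mem_harm => /andP[/eqP].
have Wn0 : W != 0%VS.
  apply: contra_neq U0 => W0; apply/eqP; rewrite -subv0; apply/subvP=> u uU.
  have /memv_imgP[x xh uE] := subvP Ucomp u uU.
  have : x \in W by rewrite memv_cap xh -memv_preim -uE.
  by rewrite W0 !memv0 => /eqP x0; rewrite uE x0 linear0 eqxx.
apply/subvP=> _ /memv_imgP[x xh ->].
have : x \in W by apply: (harmonic_mem m2 Wstable Wharm Wn0); rewrite -mem_harmE.
by rewrite memv_cap -memv_preim => /andP[].
Qed.

Definition hw_vector : SymT K m r := qmul (top_form K m k).

Lemma hw_vectorE : hw_vector = quad K m ^+ i * 'X_ord_max ^+ k :> A.
Proof. by rewrite qmulE top_formE mpolyXn. Qed.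

Lemma hw_vector_neq0 : hw_vector != 0.
Proof.
apply: contra_neq (oner_neq0 K) => w0; have t0 := qmul_eq0 w0.
have := congr1 (fun x : SymT K m k => (mpoly_of_dhomog x)@_(top_mono m k)) t0.
by rewrite top_formE mcoeffX eqxx mcoeff0.
Qed.

Lemma top_form_harm : top_form K m k \in harm_space K m k.
Proof.
rewrite mem_harm top_formE /laplacian big1 // => j _.
have d0 l (q : 'X_{1..n}) : q l = 0%N -> ('X_[q] : A)^`M(l) = 0.
  by move=> ql; rewrite mderivX ql scale0r.
have t0 l : l != ord_max -> top_mono m k l = 0%N.
  by move=> lm; rewrite mulmnE mnm1E eq_sym (negbTE lm).
have [->|jm] := eqVneq j ord_max; last by rewrite d0 ?t0 // mderiv0.
by rewrite revmax mderiv_comm d0 ?mderiv0 // t0 // ord0_neq_max.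
Qed.

Lemma hw_vector_mem : hw_vector \in component.
Proof. by apply: memv_img; apply: top_form_harm. Qed.

Lemma component_irreducible : P1_irreducible component.
Proof.
split; [|exact: component_stable|exact: component_minimal].
apply: contra_neq hw_vector_neq0 => E0.
by apply/eqP; rewrite -memv0 -E0 hw_vector_mem.
Qed.

Lemma p1_act_hw (X : 'M[K]_N) : in_so X ->
  (forall l, l != ord_max -> X (mid ord_max) (mid l) = 0) ->
  p1_act X hw_vector = (i%:R * (2 * X ord0 ord0)
    + k%:R * (X ord0 ord0 - X (mid ord_max) (mid ord_max))) *: hw_vector.
Proof.
move=> soX X0; apply: val_inj; rewrite /= sym_derE hw_vectorE.
exact: (ext_der_eigenM (ext_der_eigenX i (ext_der_quad soX))
  (ext_der_eigenX k (ext_der_top X0))).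
Qed.

Lemma highest_weight_hw :
  highest_weight_vector ((eps K m 1 + eps K m 2) *+ k + eps K m 1 *+ (2 * i)) hw_vector.
Proof.
split; first exact: hw_vector_neq0.
  move=> H /andP[soH /is_diag_mxP diagH].
  rewrite p1_act_hw // => [|l lm]; last first.
    by apply: diagH; rewrite !val_mid eqSS eq_sym.
  have H00 : weight_eval (eps K m 1) H = H ord0 ord0.
    by rewrite weight_eval_eps //; congr (H _ _); apply: val_inj; rewrite /= inordK.
  have H11 : weight_eval (eps K m 2) H = - H (mid ord_max) (mid ord_max).
    rewrite weight_eval_eps; last by case: m m2 => [|[]].
    rewrite (in_soP _ soH (mid ord_max)) opprK rev_mid revmax.
    by congr (H _ _); apply: ord_inj; rewrite val_mid inordK.
  rewrite weight_evalD !weight_evalMn weight_evalD H00 H11.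
  apply: (congr1 ( *:%R^~ hw_vector)).
  rewrite -mulr_natl -[X in _ = _ + X]mulr_natl natrM.
  by rewrite addrC; congr (_ + _); ring.
move=> X /andP[/andP[soX _] /forallP upX].
have X0 (a b : 'I_N) : (b <= a)%N -> X a b = 0.
  by move=> ba; have /forallP/(_ b)/implyP/(_ ba)/eqP := upX a.
rewrite p1_act_hw // => [|l lm]; last by apply: X0; rewrite !val_mid ltnS -ltnS.
by rewrite !X0 // subrr !mulr0 addr0 scale0r.
Qed.

End Components.

Section Decomposition.
Variables (K : numClosedFieldType) (m : nat).
Hypothesis m2 : (2 <= m)%N.
Variable r : nat.
Implicit Types i : 'I_(r./2).+1.

Lemma double_half i : (2 * i <= r)%N.
Proof. by rewrite mul2n -geq_half_double -ltnS. Qed.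

Lemma component_sum : (\sum_i component K m r (i : 'I_(r./2).+1))%VS = fullv.
Proof.
apply/eqP; rewrite eqEsubv subvf; apply/subvP=> p _.
have [h hh pE] := harmonic_exists (dhomog_is_dhomog p).
have -> : p = \sum_(i < r./2.+1) homog_part r (quad K m ^+ i * h i).
  by rewrite -linear_sum /= -pE homog_partK.
apply: memv_sumr => i _; apply/(componentP (double_half i)).
have hi := hh _ (double_half i); exists (h i) => //; have /andP[hk _] := hi.
by rewrite homog_partE //; have := quadX_homog i hk; rewrite subnKC ?double_half.
Qed.

Lemma component_direct : directv (\sum_i component K m r (i : 'I_(r./2).+1)).
Proof.
apply/directv_sum_independent => us usE us0 i _.
have /fin_all_exists[h hP] : forall i, exists h : {mpoly K[m.+1]},
    harmonic (r - 2 * i) h /\ mpoly_of_dhomog (us i) = quad K m ^+ i * h.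
  by move=> j; have /(componentP (double_half j))[h] := usE j isT; exists h.
pose h' j := if (j < r./2.+1)%N then h (inord j) else 0.
have h'E (j : 'I_(r./2).+1) : h' j = h j by rewrite /h' ltn_ord inord_val.
apply: val_inj; have [_ /= ->] := hP i; rewrite -h'E.
rewrite (harmonic_unique (r := r) (h := h')) ?double_half ?mulr0 // => [j jr|].
  have jr' : (j < r./2.+1)%N by rewrite ltnS geq_half_double -mul2n.
  by rewrite -[j]/(Ordinal jr' : nat) h'E; have [] := hP (Ordinal jr').
have := congr1 (@mpoly_of_dhomog _ _ _) us0; rewrite linear_sum /= => {2}<-.
by apply: eq_bigr => j _; rewrite h'E; have [_ ->] := hP j.
Qed.

End Decomposition.

Theorem proposition5p8 (R : realType) (m : nat) (hdim : (3 <= m.+1)%N) (r : nat) :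
  let lambda := @fund_weight R[i] m in
  exists E : 'I_(r./2).+1 -> {vspace SymT R[i] m r},
    [/\ forall i : 'I_(r./2).+1,
          is_E (if (m.+1 == 3)%N then
                  lambda 2%N *+ ((r - 2 * i) * 2) + lambda 1%N *+ (2 * i)
                else if (m.+1 == 4)%N then
                  (lambda 2%N + lambda 3%N) *+ (r - 2 * i) + lambda 1%N *+ (2 * i)
                else
                  lambda 2%N *+ (r - 2 * i) + lambda 1%N *+ (2 * i)) (E i),
        (\sum_i E i)%VS = fullv
      & directv (\sum_i E i)].
Proof.
move=> lambda; exists (fun i => component R[i] m r i).
split; [move=> i|exact: component_sum|exact: component_direct].
rewrite fund_weight_comb //; split.
  exact: component_irreducible hdim _ _ (double_half i).
exists (hw_vector R[i] m r i); first exact: hw_vector_mem hdim _ _.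
exact: highest_weight_hw hdim _ _ (double_half i).
Qed.
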